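(* Let $F$ be a graded field and $K$ a Kummer graded field extension of $F$. Let $\phi:kum(K_0/F_0)\to kum(K/F)$ be defined by $\phi(aF_0^* )=aF^*$ for $a\in KUM(K_0/F_0)$, and $\psi:kum(K/F)\to\Gamma_K/\Gamma_F$ by $\psi(aF^* )=gr(a)+\Gamma_F$ for $a\in KUM(K/F)$. Then the sequence of trivial $\Gamma_K/\Gamma_F$-modules $$1\to kum(K_0/F_0)\stackrel{\phi}{\longrightarrow}kum(K/F)\stackrel{\psi}{\longrightarrow}\Gamma_K/\Gamma_F\to 0$$ is exact.
   Context: Gradings are by torsion-free (totally ordered) abelian groups. A graded field is a commutative graded ring in which every nonzero homogeneous element is invertible; its unit group $F^*$ consists exactly of the nonzero homogeneous elements. $\Gamma_F$ is the support (group of degrees) of $F$, $gr(x)$ the degree of a nonzero homogeneous $x$, and $F_0$ the degree-$0$ component (a field). A finite-dimensional graded field extension $K/F$ is abelian if $Frac(K)/Frac(F)$ is an abelian Galois field extension ($Gal(K/F)$ is then its Galois group); it is a Kummer graded field extension if moreover $F_0$ contains a primitive $m$-th root of unity, where $m$ is the exponent of $Gal(K/F)$. In that case $KUM(K/F)=\{x\in K^*: x^m\in F\}$ and $kum(K/F)=KUM(K/F)/F^*$. For the ordinary Kummer field extension $K_0/F_0$, $KUM(K_0/F_0)$ and $kum(K_0/F_0)=KUM(K_0/F_0)/F_0^*$ are defined in the same way, with the exponent of $Gal(K_0/F_0)$. *)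

(* Defs.v *)
From HB Require Import structures.
From mathcomp Require Import all_boot all_order all_fingroup all_algebra.
From mathcomp Require Import all_solvable all_field.
From mathcomp Require Import mathcomp_extra boolp classical_sets.

Set Implicit Arguments.
Unset Strict Implicit.
Unset Printing Implicit Defensive.

Import GRing.Theory.
Local Open Scope ring_scope.
Local Open Scope quotient_scope.

Local Notation "x %:F" := (@FracField.tofrac _ x).

HB.mixin Record isTorsionFree V of GRing.Zmodule V := {
  torsion_free : forall (x : V) (n : nat), x *+ n.+1 = 0 -> x = 0
}.

#[short(type="torsionFreeZmodType")]
HB.structure Definition TorsionFree := {V of GRing.Zmodule V & isTorsionFree V}.

(* R is the internal direct sum of the subgroups G g, and 1 and products are
   homogeneous of the expected degree. *)
Record grading (T : zmodType) (R : pzRingType) (G : T -> {pred R}) : Prop :=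
  Grading {
    grading_zmod : forall g, zmod_closed (G g);
    grading_span : forall x, exists s : seq T, exists f : T -> R,
      (forall g, f g \in G g) /\ x = \sum_(g <- s) f g;
    grading_free : forall (s : seq T) (f : T -> R), uniq s ->
      (forall g, f g \in G g) -> \sum_(g <- s) f g = 0 ->
      forall g, g \in s -> f g = 0;
    grading1 : 1 \in G 0;
    gradingM : forall g h x y, x \in G g -> y \in G h -> x * y \in G (g + h) }.

Lemma big_uniq_pred1 (V : nmodType) (I : eqType) (s : seq I) (j : I) (F : I -> V) :
  uniq s -> j \in s -> \sum_(h <- s | h == j) F h = F j.
Proof. by move=> us js; rewrite -big_filter filter_pred1_uniq // big_seq1. Qed.

(* Torsion-free abelian groups can be totally ordered; hence a graded field is
   an integral domain and its units are homogeneous. *)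
Section Order.
Variable T : torsionFreeZmodType.

Definition cone (P : set T) : Prop :=
  [/\ P 0, forall x y, P x -> P y -> P (x + y)
     & forall x, P x -> P (- x) -> x = 0].

Let ccone (P : set T) : Prop := cone (P `|` [set 0])%classic.

Lemma cone_mulrn P x n : cone P -> P x -> P (x *+ n).
Proof.
by case=> P0 PD _ Px; elim: n => [|n IHn]; rewrite ?mulr0n // mulrS; apply: PD.
Qed.

Lemma cone_adjoin P x : cone P ->
  (forall n, P (- (x *+ n.+1)) -> False) ->
  cone [set y | exists p n, P p /\ y = p + x *+ n]%classic.
Proof.
move=> cP nP; have [P0 PD PN] := cP; split.
- by exists 0, 0%N; rewrite mulr0n addr0.
- move=> _ _ [p [n [Pp ->]]] [q [m [Pq ->]]].
  exists (p + q), (n + m)%N; split; first exact: PD.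
  by rewrite mulrnDr addrACA.
- move=> _ [p [n [Pp ->]]] [q [m [Pq /eqP]]].
  rewrite eq_sym -addr_eq0 addrACA addrC -mulrnDr addr_eq0 => /eqP e.
  case E : (m + n)%N e => [|k] e.
    move/eqP: E; rewrite addn_eq0 => /andP[_ /eqP->]; rewrite mulr0n addr0.
    move/eqP: e; rewrite mulr0n eq_sym oppr_eq0 addr_eq0 => /eqP e.
    by apply: PN => //; rewrite -?e // e opprK.
  by case: (nP k); rewrite e opprK; apply: PD.
Qed.

Lemma total_cone : exists P, cone P /\ forall x, P x \/ P (- x).
Proof.
have [|P [cP maxP]] := @Zorn_bigcup T ccone.
  move=> F FP Ftot; split; first by right.
  - move=> x y [[A FA Ax]|/= x0] [[B FB By]|/= y0].
    + have [AB|BA] := Ftot _ _ FA FB.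
      * have [_ D _] := FP _ FB.
        have [h|h] := D x y (or_introl (AB _ Ax)) (or_introl By); last by right.
        by left; exists B.
      * have [_ D _] := FP _ FA.
        have [h|h] := D x y (or_introl Ax) (or_introl (BA _ By)); last by right.
        by left; exists A.
    + by rewrite y0 addr0; left; exists A.
    + by rewrite x0 add0r; left; exists B.
    + by right; rewrite /= x0 y0 addr0.
  - move=> x [[A FA Ax]|//] [[B FB By]|/= /eqP]; last first.
      by rewrite oppr_eq0 => /eqP.
    have [AB|BA] := Ftot _ _ FA FB.
      by have [_ _ N] := FP _ FB; apply: N; left=> //; apply: AB.
    by have [_ _ N] := FP _ FA; apply: N; left=> //; apply: BA.
pose Q := (P `|` [set 0])%classic.
exists Q; split=> // x.
have adj z : (forall n, Q (- (z *+ n.+1)) -> False) -> Q z.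
  move=> nQ; have cQ := cone_adjoin cP nQ.
  set Q' := (X in cone X) in cQ.
  have QQ' : (Q `<=` Q')%classic by move=> y Qy; exists y, 0%N; rewrite addr0.
  have PQ' : (P `<=` Q')%classic by move=> y Py; apply: QQ'; left.
  have Q'E : (Q' `|` [set 0])%classic = Q'.
    by apply/seteqP; split=> [y [//|->]|y]; [apply: QQ'; right|left].
  have -> : Q = Q'.
    rewrite -Q'E /Q; case: (pselect (P = Q')) => [->//|ne].
    exfalso; apply: (maxP Q'); last by rewrite /ccone Q'E.
    by split=> // Q'P; apply: ne; apply/seteqP; split.
  by exists 0, 1%N; split; [right | rewrite add0r].
case: (pselect (Q x)) => [|nx]; first by left.
case: (pselect (Q (- x))) => [|nNx]; first by right.
have [n Qn] : exists n, Q (- (x *+ n.+1)).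
  by apply: contrapT => h; apply: nx; apply: adj => n Qn; apply: h; exists n.
have [m Qm] : exists m, Q (- (- x *+ m.+1)).
  by apply: contrapT => h; apply: nNx; apply: adj => n' Qn'; apply: h; exists n'.
rewrite mulNrn opprK in Qm.
have h1 := cone_mulrn n.+1 cP Qm; have h2 := cone_mulrn m.+1 cP Qn.
have [Q0 _ N] := cP.
have /torsion_free x0 : x *+ m.+1 *+ n.+1 = 0.
  by apply: N => //; move: h2; rewrite mulNrn mulrnAC.
by left; rewrite (torsion_free _ _ x0).
Qed.

Lemma torsion_free_order : exists le : rel T,
  [/\ reflexive le, antisymmetric le, transitive le, total le
     & forall z, {homo +%R z : x y / le x y}].
Proof.
have [P [[P0 PD PN] Ptot]] := total_cone.
exists (fun x y => `[< P (y - x) >]); split.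
- by move=> x; apply/asboolP; rewrite subrr.
- move=> x y /andP[/asboolP xy /asboolP yx].
  by apply/esym/subr0_eq/PN => //; rewrite opprB.
- move=> y x z /asboolP xy /asboolP yz; apply/asboolP.
  by rewrite -(subrKA y z); apply: PD.
- move=> x y; apply/orP; have [h|h] := Ptot (y - x); [left|right]; apply/asboolP => //.
  by rewrite -opprB.
- move=> z x y /asboolP xy; apply/asboolP.
  by rewrite opprD addrACA subrr add0r.
Qed.

End Order.

Section GradingTheory.
Variables (T : torsionFreeZmodType) (R : comUnitRingType) (G : T -> {pred R}).
Hypothesis gG : grading G.
Hypothesis Gunit : forall g x, x \in G g -> x != 0 -> x \is a GRing.unit.

Let G0 g : 0 \in G g. Proof. by case: (grading_zmod gG g). Qed.
Let GD g x y : x \in G g -> y \in G g -> x + y \in G g.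
Proof.
have [z0 zB] := grading_zmod gG g => xg yg.
by rewrite -[y]opprK -[- y]add0r; apply: (zB) => //; apply: (zB).
Qed.

Lemma grading_component (I : eqType) (r : seq I) (d : I -> T) (z : I -> R) g :
  (forall i, z i \in G (d i)) -> \sum_(i <- r) z i = 0 ->
  \sum_(i <- r | d i == g) z i = 0.
Proof.
move=> zG z0.
pose F g := \sum_(i <- r | d i == g) z i.
have FG h : F h \in G h.
  by apply: (big_ind (fun v => v \in G h)) => [|x y|i /eqP <-]; [exact: G0|exact: GD|exact: zG].
have [gr|gr] := boolP (g \in undup (map d r)); last first.
  rewrite big_seq_cond big1 // => i /andP[ir /eqP dg]; case/negP: gr.
  by rewrite mem_undup -dg map_f.
apply: (grading_free gG (undup_uniq _) FG _ gr).
rewrite -[RHS]z0 /F; under eq_bigr do rewrite big_mkcond /=.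
rewrite exchange_big /= big_seq [RHS]big_seq; apply: eq_bigr => i ir.
rewrite -big_mkcond /= (eq_bigl (fun j => j == d i)); last by move=> j; rewrite eq_sym.
by rewrite big_uniq_pred1 ?undup_uniq // mem_undup map_f.
Qed.

Lemma grading_support x : x != 0 -> exists s : seq T, exists f : T -> R,
  [/\ uniq s, s != [::], forall g, f g \in G g, forall g, g \in s -> f g != 0
    & x = \sum_(g <- s) f g].
Proof.
move=> nx; have [s [f [fG xE]]] := grading_span gG x.
pose F g := \sum_(i <- s | i == g) f i.
have FG h : F h \in G h.
  by apply: (big_ind (fun v => v \in G h)) => [|a b|i /eqP <-]; [exact: G0|exact: GD|exact: fG].
have E : x = \sum_(g <- [seq g <- undup s | F g != 0]) F g.
  rewrite big_filter big_mkcond xE /=.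
  transitivity (\sum_(g <- undup s) F g); last first.
    by apply: eq_bigr => g _; case: eqVneq => [->|].
  rewrite /F; under [RHS]eq_bigr do rewrite big_mkcond /=.
  rewrite exchange_big /= big_seq [RHS]big_seq; apply: eq_bigr => i ir.
  rewrite -big_mkcond /= (eq_bigl (fun j => j == i)); last by move=> j; rewrite eq_sym.
  by rewrite big_uniq_pred1 ?undup_uniq // mem_undup.
exists [seq g <- undup s | F g != 0], F; split=> //.
- by rewrite filter_uniq ?undup_uniq.
- by apply: contraNneq nx => e; rewrite E e big_nil.
- by move=> g; rewrite mem_filter => /andP[].
Qed.

Section Leading.
Variable le : rel T.
Hypothesis le_refl : reflexive le.
Hypothesis le_anti : antisymmetric le.
Hypothesis le_trans : transitive le.
Hypothesis le_total : total le.
Hypothesis leD : forall z, {homo +%R z : x y / le x y}.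

Lemma seq_max (s : seq T) : s != [::] ->
  exists2 a, a \in s & forall g, g \in s -> le g a.
Proof.
elim: s => // x [_ _|y s /(_ isT)[a ain amax] _].
  by exists x; rewrite ?mem_head // => g; rewrite inE => /eqP->.
have [xa|ax] := orP (le_total x a).
  exists a; first by rewrite inE ain orbT.
  by move=> g; rewrite inE => /orP[/eqP->|/amax].
exists x; first by rewrite mem_head.
by move=> g; rewrite inE => /orP[/eqP->//|/amax ga]; apply: le_trans ax.
Qed.

Lemma leading_term (s t : seq T) (f f' : T -> R) a b c z :
  uniq s -> uniq t -> (forall g, f g \in G g) -> (forall g, f' g \in G g) ->
  a \in s -> b \in t -> f a != 0 -> f' b != 0 ->
  (forall g, g \in s -> le g a) -> (forall h, h \in t -> le h b) ->
  (\sum_(g <- s) f g) * (\sum_(h <- t) f' h) = z -> z \in G c ->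
  a + b = c /\ z != 0.
Proof.
move=> us ut fG fG' sa tb fa fb ma mb zE zG.
have nab : f a * f' b != 0.
  apply: contraTneq (Gunit (fG a) fa) => e.
  have := Gunit (fG' b) fb; case: (boolP (f a \is a GRing.unit)) => // ua _.
  by case/negP: fb; rewrite -(mulKr ua (f' b)) e mulr0.
have [zn|] := boolP ((a + b != c) || (z == 0)); last first.
  by rewrite negb_or negbK => /andP[/eqP].
pose r : seq (option (T * T)) :=
  None :: [seq Some p | p <- [seq (g, h) | g <- s, h <- t]].
pose d o := if o is Some p then p.1 + p.2 else c.
pose w o := if o is Some p then f p.1 * f' p.2 else - z.
have wG o : w o \in G (d o).
  case: o => [p|] /=; first exact: (gradingM gG).
  by have [z0 zB] := grading_zmod gG c; rewrite -sub0r zB.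
have w0 : \sum_(o <- r) w o = 0.
  rewrite big_cons big_map big_allpairs /= -zE mulr_suml.
  by apply/eqP; rewrite addrC subr_eq0; apply/eqP; apply: eq_bigr => g _;
     rewrite mulr_sumr.
have /eqP := grading_component (a + b) wG w0.
rewrite big_cons /=.
have -> : forall S, (if c == a + b then - z + S else S) = S.
  move=> S; case: eqP => // e; move: zn; rewrite e eqxx /= => /eqP->.
  by rewrite oppr0 add0r.
rewrite big_map big_seq_cond (eq_bigl (fun p => p == (a, b))) /=.
  rewrite big_uniq_pred1 /= ?(negPf nab) //.
    by rewrite allpairs_uniq // => -[? ?] [? ?] _ _ [-> ->].
  by apply/allpairsP; exists (a, b).
move=> [g h] /=; apply/andP/eqP => [[]|[-> ->]]; last first.
  by split=> //; apply/allpairsP; exists (a, b).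
case/allpairsP=> -[g' h'] [/= gs ht [-> ->]] /eqP e.
have h1 : le (a + b) (a + h').
  rewrite -e ![_ + h']addrC; apply: leD; exact: ma.
have e2 : h' = b.
  apply: le_anti; rewrite mb //=.
  by have := leD (- a) h1; rewrite !addKr.
by rewrite e2 in e *; move/addIr: e => ->.
Qed.

End Leading.

Lemma graded_field_domain : GRing.integral_domain_axiom R.
Proof.
move=> x y xy; apply/orP; case: eqVneq => [|nx]; first by left.
case: eqVneq => [|ny]; [by right|exfalso].
have [le [r a t tt lD]] := torsion_free_order T.
have [s [f [us s0 fG fn xE]]] := grading_support nx.
have [s' [f' [us' s0' fG' fn' yE]]] := grading_support ny.
have [u us_ mu] := seq_max r t tt s0; have [v vs_ mv] := seq_max r t tt s0'.
have := leading_term a lD us us' fG fG' us_ vs_ (fn _ us_) (fn' _ vs_) mu mv.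
by rewrite -xE -yE => /(_ 0 _ xy (G0 0))[_]; rewrite eqxx.
Qed.

Lemma graded_unit_homogeneous x : x \is a GRing.unit -> exists g, x \in G g.
Proof.
move=> ux; have xy := divrr ux.
have n1 : (1 : R) != 0 := oner_neq0 _.
have nx : x != 0 by apply: contraTneq ux => ->; rewrite unitr0.
have ny : x^-1 != 0 by rewrite invr_eq0.
have [le [r a t tt lD]] := torsion_free_order T.
have [s [f [us s0 fG fn xE]]] := grading_support nx.
have [s' [f' [us' s0' fG' fn' yE]]] := grading_support ny.
pose ge := fun x y => le y x.
have gr : reflexive ge by move=> ?; apply: r.
have ga : antisymmetric ge by move=> ? ?; rewrite andbC; apply: a.
have gt : transitive ge by move=> ? ? ? h1 h2; apply: t h2 h1.
have gtt : total ge by move=> ? ?; apply: tt.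
have gD z : {homo +%R z : x y / ge x y} by move=> ? ?; apply: lD.
have [u us_ mu] := seq_max r t tt s0; have [v vs_ mv] := seq_max r t tt s0'.
have [u' us_' mu'] := seq_max gr gt gtt s0.
have [v' vs_' mv'] := seq_max gr gt gtt s0'.
have := leading_term a lD us us' fG fG' us_ vs_ (fn _ us_) (fn' _ vs_) mu mv.
rewrite -xE -yE => /(_ 0 _ xy (grading1 gG))[uv _].
have := leading_term ga gD us us' fG fG' us_' vs_' (fn _ us_') (fn' _ vs_') mu' mv'.
rewrite -xE -yE => /(_ 0 _ xy (grading1 gG))[uv' _].
have le_uu' : le u u'.
  have /(lD u) : le v' v by exact: mv.
  by rewrite uv => /(lD u'); rewrite addr0 addrCA uv' addr0.
exists u; rewrite xE big_seq; apply: (big_ind (fun v => v \in G u)) => //.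
  exact: GD.
move=> g gs; have -> : u = g; last exact: fG.
apply: a; rewrite (mu _ gs) andbT; apply: t le_uu' _; exact: mu'.
Qed.

Lemma graded_degree_unique g h x :
  x \in G g -> x \in G h -> x != 0 -> g = h.
Proof.
move=> xg xh nx; apply/eqP; apply: contraNT nx => ngh.
pose z (b : bool) := if b then x else - x.
have zG b : z b \in G (if b then g else h).
  by case: b => //=; have [z0 zB] := grading_zmod gG h; rewrite -sub0r zB.
have /(grading_component g zG) : \sum_(b <- [:: true; false]) z b = 0.
  by rewrite big_cons big_seq1 subrr.
by rewrite !big_cons big_nil eqxx eq_sym (negPf ngh) /= addr0 => ->.
Qed.

Lemma graded_inv g x : x \in G g -> x^-1 \in G (- g).
Proof.
have [->|nx] := eqVneq x 0; first by rewrite invr0 G0.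
move=> xg; have ux := Gunit xg nx.
have [k yk] : exists k, x^-1 \in G k.
  by apply: graded_unit_homogeneous; rewrite unitrV.
have := gradingM gG xg yk; rewrite divrr // => h1.
have /eqP := graded_degree_unique h1 (grading1 gG) (oner_neq0 _).
by rewrite addrC addr_eq0 => /eqP <-.
Qed.

End GradingTheory.

HB.mixin Record IntegralDomain_isGradedField (T : torsionFreeZmodType) K
    of GRing.IntegralDomain K := {
  grade : T -> {pred K};
  gradingP : grading grade;
  grade_unit : forall g x, x \in grade g -> x != 0 -> x \is a GRing.unit
}.

#[short(type="gradedFieldType")]
HB.structure Definition GradedField (T : torsionFreeZmodType) :=
  {K of GRing.IntegralDomain K & IntegralDomain_isGradedField T K}.

(* By graded_field_domain, integrality need not be assumed. *)
HB.factory Record ComUnitRing_isGradedField (T : torsionFreeZmodType) K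
    of GRing.ComUnitRing K := {
  grade : T -> {pred K};
  gradingP : grading grade;
  grade_unit : forall g x, x \in grade g -> x != 0 -> x \is a GRing.unit
}.

HB.builders Context T K of ComUnitRing_isGradedField T K.
HB.instance Definition _ := GRing.ComUnitRing_isIntegral.Build K
  (graded_field_domain gradingP grade_unit).
HB.instance Definition _ := IntegralDomain_isGradedField.Build T K
  gradingP grade_unit.
HB.end.
Arguments grade_unit {T s g x}.

Section GradedField.
Variables (T : torsionFreeZmodType) (K : gradedFieldType T).

Lemma grade_inv g (x : K) : x \in grade g -> x^-1 \in grade (- g).
Proof. exact: (graded_inv gradingP (@grade_unit T K)). Qed.

Definition supp : {pred T} :=
  [pred g | `[< exists2 x : K, x != 0 & x \in grade g >]].

Lemma supp_zmod_closed : zmod_closed supp.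
Proof.
split; first by apply/asboolP; exists 1; [exact: oner_neq0|exact: (grading1 gradingP)].
move=> g h /asboolP[x nx xg] /asboolP[y ny yh]; apply/asboolP.
exists (x / y); first by rewrite mulf_neq0 ?invr_eq0.
by apply: (gradingM gradingP) => //; apply: grade_inv.
Qed.
HB.instance Definition _ := GRing.isZmodClosed.Build T supp supp_zmod_closed.

(* Meaningful for x homogeneous and nonzero only. *)
Definition gr (x : K) : T := xget 0 [set g | x \in grade g]%classic.

Definition deg0_pred : {pred K} := [pred x | x \in grade 0].

Lemma deg0_divring_closed : divring_closed deg0_pred.
Proof.
have [_ zB] := grading_zmod (@gradingP T K) 0.
split; [exact: (grading1 gradingP)|exact: zB|move=> x y x0 y0].
rewrite inE -(addr0 0); apply: (gradingM gradingP) => //.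
by rewrite -oppr0; apply: grade_inv.
Qed.
HB.instance Definition _ :=
  GRing.isDivringClosed.Build K deg0_pred deg0_divring_closed.

Definition deg0 : Type := {x : K | x \in deg0_pred}.
HB.instance Definition _ := [isSub of deg0 for val].
HB.instance Definition _ := [Choice of deg0 by <:].
HB.instance Definition _ := [SubChoice_isSubComUnitRing of deg0 by <:].
HB.instance Definition _ := [SubComUnitRing_isSubIntegralDomain of deg0 by <:].

Lemma deg0_field : GRing.field_axiom deg0.
Proof.
move=> x nx; have x0 : val x \in grade 0 := valP x.
by apply: (grade_unit x0); rewrite -(inj_eq val_inj) in nx.
Qed.
HB.instance Definition _ := GRing.UnitRing_isField.Build deg0 deg0_field.

Definition degGroup : Type := {g : T | g \in supp}.
HB.instance Definition _ := [isSub of degGroup for val].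
HB.instance Definition _ := [Choice of degGroup by <:].
HB.instance Definition _ := [SubChoice_isSubZmodule of degGroup by <:].

End GradedField.

Arguments supp {T} K.
Arguments deg0_pred {T} K.
Arguments deg0 {T} K.
Arguments degGroup {T} K.

(* A ring extension S/R reflecting units, so that {x in S^* | x ^+ m in R} is a
   subgroup of S^*. *)
Record unitExt (R S : comUnitRingType) := UnitExt {
  unitExt_morph :> {rmorphism R -> S};
  unitExt_unit : forall a, unitExt_morph a \is a GRing.unit -> a \is a GRing.unit
}.

Section KUM.
Variables (R S : comUnitRingType) (i : unitExt R S) (m : nat).

Definition KUM_pred : {pred S} :=
  [pred x | (x \is a GRing.unit) && `[< exists a, x ^+ m = i a >]].

Definition KUM : Type := {x : S | x \in KUM_pred}.
HB.instance Definition _ := [isSub of KUM for val].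
HB.instance Definition _ := [Choice of KUM by <:].

Lemma KUM1 : 1 \in KUM_pred.
Proof. by rewrite inE unitr1; apply/asboolP; exists 1; rewrite expr1n rmorph1. Qed.

Lemma KUMM x y : x \in KUM_pred -> y \in KUM_pred -> x * y \in KUM_pred.
Proof.
move=> /andP[ux /asboolP[a xa]] /andP[uy /asboolP[b yb]].
rewrite inE unitrMl // ux; apply/asboolP; exists (a * b).
by rewrite exprMn xa yb rmorphM.
Qed.

Lemma KUMV x : x \in KUM_pred -> x^-1 \in KUM_pred.
Proof.
move=> /andP[ux /asboolP[a xa]]; rewrite inE unitrV ux; apply/asboolP.
have ua : a \is a GRing.unit by apply: (@unitExt_unit _ _ i); rewrite -xa unitrX.
by exists a^-1; rewrite exprVn xa rmorphV.
Qed.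

(* As a subgroup of S^*, KUM is abelian: its multiplication, 1 and inverse are
   the +, 0 and - of a zmodType, for which quotients are available. *)
Definition KUM_mul (x y : KUM) : KUM := Sub (val x * val y) (KUMM (valP x) (valP y)).
Definition KUM_one : KUM := Sub 1 KUM1.
Definition KUM_inv (x : KUM) : KUM := Sub (val x)^-1 (KUMV (valP x)).

Lemma KUM_mulA : associative KUM_mul.
Proof. by move=> x y z; apply/val_inj; rewrite /= mulrA. Qed.
Lemma KUM_mulC : commutative KUM_mul.
Proof. by move=> x y; apply/val_inj; rewrite /= mulrC. Qed.
Lemma KUM_mul1 : left_id KUM_one KUM_mul.
Proof. by move=> x; apply/val_inj; rewrite /= mul1r. Qed.
Lemma KUM_mulV : left_inverse KUM_one KUM_inv KUM_mul.
Proof.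
by move=> x; apply/val_inj; rewrite /= mulVr //; case/andP: (valP x).
Qed.
HB.instance Definition _ :=
  GRing.isZmodule.Build KUM KUM_mulA KUM_mulC KUM_mul1 KUM_mulV.

(* R^* as a subgroup of KUM, so that kum is KUM/R^*. *)
Definition baseUnits : {pred KUM} :=
  [pred x | `[< exists2 u, u \is a GRing.unit & val x = i u >]].

Lemma baseUnits_zmod_closed : zmod_closed baseUnits.
Proof.
split; first by apply/asboolP; exists 1; rewrite ?unitr1 ?rmorph1.
move=> x y /asboolP[u uu xu] /asboolP[v uv yv]; apply/asboolP.
exists (u / v); first by rewrite unitrMl ?unitrV.
by rewrite /= xu yv rmorphM rmorphV.
Qed.
HB.instance Definition _ :=
  GRing.isZmodClosed.Build KUM baseUnits baseUnits_zmod_closed.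

Definition kum : zmodType := Quotient.quot baseUnits.
Definition kum_class : KUM -> kum := \pi_(Quotient.quot baseUnits).

End KUM.

(* splittingFieldType k carries its own k-algebra structure, so a given extension
   i : k -> E is Galois when it is isomorphic over k to a Galois extension in
   that sense. *)
Record galoisModel (k E : fieldType) (i : k -> E) := GaloisModel {
  model_field :> splittingFieldType k;
  model_iso : {rmorphism model_field -> E};
  model_bij : bijective model_iso;
  model_base : forall a, model_iso a%:A = i a;
  model_galois : galois 1 {: model_field}
}.

Section FieldExt.
Variables (k E : fieldType) (i : k -> E).

Definition abelian_ext : Prop :=
  exists M : galoisModel i, abelian 'Gal({: M} / 1).

(* The exponent of Gal(E/k); 0 if E/k is not finite Galois. *)
Definition gal_exponent : nat :=
  xget 0%N [set n | exists M : galoisModel i, n = exponent 'Gal({: M} / 1)]%classic.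

End FieldExt.

Record gradedExt (T : torsionFreeZmodType) (F K : gradedFieldType T) :=
  GradedExt {
    gradedExt_morph :> {rmorphism F -> K};
    gradedExt_grade : forall g x, x \in grade g -> gradedExt_morph x \in grade g
  }.

Section GradedExt.
Variables (T : torsionFreeZmodType) (F K : gradedFieldType T).
Variable iota : gradedExt F K.

Lemma gradedExt_unit a : iota a \is a GRing.unit -> a \is a GRing.unit.
Proof.
move=> ua.
have [g ag] := graded_unit_homogeneous gradingP (@grade_unit T K) ua.
have na : a != 0 by apply: contraTneq ua => ->; rewrite rmorph0 unitr0.
have [s [f [us s0 fG fn aE]]] := grading_support (@gradingP T F) na.
have sg h : h \in s -> h = g.
  move=> hs; apply/eqP; apply: contraT => nhg.
  pose d o := if o is Some h then h else g : T.
  pose z o := if o is Some h then iota (f h) else - iota a.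
  have zG o : z o \in grade (d o).
    case: o => [h'|] /=; first exact: gradedExt_grade.
    by have [z0 zB] := grading_zmod (@gradingP T K) g; rewrite -sub0r zB.
  have /(grading_component gradingP h zG) :
      \sum_(o <- None :: [seq Some h | h <- s]) z o = 0.
    by rewrite big_cons big_map /= -rmorph_sum -aE addNr.
  rewrite big_cons /= eq_sym (negPf nhg) big_map /= (big_uniq_pred1 _ us hs).
  have := grade_unit (fG h) (fn h hs) => /(rmorph_unit iota) /[swap] ->.
  by rewrite unitr0.
case: s => // h s in us s0 fn aE sg *.
case: s => [|h' s] in us s0 fn aE sg *.
  rewrite aE big_seq1; apply: (grade_unit (fG h)); exact/fn/mem_head.
have eh : h = g by apply: sg; rewrite inE eqxx.
have eh' : h' = g by apply: sg; rewrite !inE eqxx orbT.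
by move: us; rewrite eh eh' /= inE eqxx.
Qed.

Definition graded_unitExt : unitExt F K := UnitExt gradedExt_unit.

Lemma ext0_subproof (x : deg0 F) : iota (val x) \in deg0_pred K.
Proof. exact: gradedExt_grade (valP x). Qed.
Definition ext0 (x : deg0 F) : deg0 K := Sub (iota (val x)) (ext0_subproof x).

Lemma ext0_zmod : zmod_morphism ext0.
Proof. by move=> x y; apply/val_inj; rewrite /= !rmorphB. Qed.
Lemma ext0_monoid : monoid_morphism ext0.
Proof. by split=> [|x y]; apply/val_inj; rewrite /= ?rmorph1 ?rmorphM. Qed.
HB.instance Definition _ :=
  GRing.isZmodMorphism.Build (deg0 F) (deg0 K) ext0 ext0_zmod.
HB.instance Definition _ :=
  GRing.isMonoidMorphism.Build (deg0 F) (deg0 K) ext0 ext0_monoid.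

Lemma ext0_unit a : ext0 a \is a GRing.unit -> a \is a GRing.unit.
Proof. by rewrite fmorph_unit unitfE. Qed.

Definition ext0_unitExt : unitExt (deg0 F) (deg0 K) := UnitExt ext0_unit.

(* Independent of the representative, as iota is injective. *)
Definition frac_ext (x : {fraction F}) : {fraction K} :=
  (iota \n_(generic_quotient.repr x))%:F / (iota \d_(generic_quotient.repr x))%:F.

(* Graded vector spaces over a graded field are free, with a well-defined rank. *)
Definition finite_dim : Prop :=
  exists (n : nat) (b : 'I_n -> K),
    forall x, exists! c : {ffun 'I_n -> F}, x = \sum_i iota (c i) * b i.

Definition abelian_graded : Prop := finite_dim /\ abelian_ext frac_ext.

(* Gal(K/F) is Gal(Frac(K)/Frac(F)). *)
Definition graded_exponent : nat := gal_exponent frac_ext.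

Definition kummer_graded : Prop :=
  abelian_graded /\ exists z : deg0 F, graded_exponent.-primitive_root z.

Definition gKUM := KUM graded_unitExt graded_exponent.
Definition gkum := kum graded_unitExt graded_exponent.
Definition KUM0 := KUM ext0_unitExt (gal_exponent ext0).
Definition kum0 := kum ext0_unitExt (gal_exponent ext0).

Definition base_degrees : {pred degGroup K} := [pred g | val g \in supp F].
Lemma base_degrees_zmod_closed : zmod_closed base_degrees.
Proof.
have [s0 sB] := supp_zmod_closed F.
by split=> [|g h gF hF]; [exact: s0|exact: sB gF hF].
Qed.
HB.instance Definition _ := GRing.isZmodClosed.Build (degGroup K) base_degrees
  base_degrees_zmod_closed.

Definition degQuot : zmodType := Quotient.quot base_degrees.
Definition degree_class : degGroup K -> degQuot :=
  \pi_(Quotient.quot base_degrees).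

End GradedExt.

Definition short_exact (A B C : zmodType)
    (f : {additive A -> B}) (g : {additive B -> C}) : Prop :=
  [/\ injective f, forall b, g b = 0 <-> exists a, f a = b
    & forall c, exists b, g b = c].

Arguments degQuot {T} F K.
Arguments degree_class {T} F {K}.

(* Main.v *)
Require Import Defs.
From HB Require Import structures.
From mathcomp Require Import all_boot all_order all_fingroup all_algebra.
From mathcomp Require Import all_solvable all_field.
From mathcomp Require Import boolp.

Set Implicit Arguments.
Unset Strict Implicit.
Unset Printing Implicit Defensive.

Import GRing.Theory.
Local Open Scope ring_scope.

(** Injectivity of phi and the composite psi phi = 0 are degree considerations.
    The content is in three facts, with m the exponent of Gal(K/F) and m0 that
    of Gal(K_0/F_0).

    Surjectivity of psi. By ordinary Kummer theory every element y of Frac(K) is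
    a sum of m-th roots of elements of Frac(F) (kummer_decomposition). For y in
    K homogeneous, clearing denominators writes c y, for some nonzero c in F, as
    a sum of elements w of K with w^m in F (frac_sum_numerators). The point is
    that such a w is, up to a factor in F, its own leading term for a total
    order on the degrees (homogeneous_root): an element t with leading term 1
    and t^m in F lies in F, because the highest component of t outside F would
    appear, multiplied by m, in t^m. Hence all the homogeneous components of w
    are again m-th roots of elements of F, and comparing components in one
    degree of c y exhibits y as a sum of homogeneous m-th roots of its own
    degree (graded_kummer_decomposition). If y is nonzero, so is one of them.

    K_0/F_0 is a finite Galois extension and m0 divides m. In degree 0 the
    decomposition shows that K_0 is generated over F_0 by m-th roots, finitely
    many by finite_dim; as F_0 contains the m-th roots of unity, K_0 is a
    separable splitting field (deg0_model). An automorphism multiplies each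
    generator by an m-th root of unity of F_0, so its m-th power is trivial
    (deg0_exponent_dvd). So phi makes sense.

    Exactness in the middle. An element of KUM(K/F) whose degree comes from F is
    a unit of F times some y in K_0 with y^m in F_0. The character
    s |-> s(y)/y of Gal(K_0/F_0) has order dividing m0, so that y^m0 is in F_0
    (deg0_root_exponent). *)

(** * Homogeneous components *)

Section Components.
Variables (T : torsionFreeZmodType) (K : gradedFieldType T).
Implicit Types (g h : T) (x y : K).

Lemma grade0 g : (0 : K) \in grade g.
Proof. by have [] := grading_zmod (@gradingP T K) g. Qed.

Lemma gradeB g x y : x \in grade g -> y \in grade g -> x - y \in grade g.
Proof. by have [_ zB] := grading_zmod (@gradingP T K) g => xg yg; apply: zB. Qed.

Lemma gradeN g x : x \in grade g -> - x \in grade g.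
Proof. by move=> xg; rewrite -sub0r; apply: gradeB => //; exact: grade0. Qed.

Lemma gradeD g x y : x \in grade g -> y \in grade g -> x + y \in grade g.
Proof.
by move=> xg yg; rewrite -[y]opprK; apply: gradeB => //; exact: gradeN.
Qed.

Lemma grade_sum (I : Type) (r : seq I) (P : pred I) (z : I -> K) g :
  (forall i, P i -> z i \in grade g) -> \sum_(i <- r | P i) z i \in grade g.
Proof.
move=> zG; apply: (big_ind (fun x => x \in grade g)) => //; first exact: grade0.
by move=> x y; exact: gradeD.
Qed.

Lemma gradeM g h x y : x \in grade g -> y \in grade h -> x * y \in grade (g + h).
Proof. exact: (gradingM gradingP). Qed.

Lemma gradeX g x n : x \in grade g -> x ^+ n \in grade (g *+ n).
Proof.
move=> xg; elim: n => [|n IHn]; first exact: (grading1 gradingP).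
by rewrite exprS mulrS gradeM.
Qed.

Let decomposition x : exists sf : seq T * (T -> K),
  [/\ uniq sf.1, forall g, sf.2 g \in grade g & x = \sum_(g <- sf.1) sf.2 g].
Proof.
have [->|nx] := eqVneq x 0.
  by exists ([::], fun=> 0); rewrite big_nil; split=> // g; exact: grade0.
by have [s [f [us _ fG _ xE]]] := grading_support gradingP nx; exists (s, f).
Qed.

Definition supp_seq x : seq T := (projT1 (cid (decomposition x))).1.

Definition comp g x : K :=
  \sum_(h <- supp_seq x | h == g) (projT1 (cid (decomposition x))).2 h.

Lemma comp_grade g x : comp g x \in grade g.
Proof.
by apply: grade_sum => h /eqP <-; case: (projT2 (cid (decomposition x))).
Qed.

Lemma supp_seq_uniq x : uniq (supp_seq x).
Proof. by case: (projT2 (cid (decomposition x))). Qed.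

Lemma comp_sum x : x = \sum_(g <- supp_seq x) comp g x.
Proof.
have [us fG xE] := projT2 (cid (decomposition x)).
rewrite [LHS]xE big_seq [RHS]big_seq; apply: eq_bigr => g gs.
by rewrite /comp big_uniq_pred1.
Qed.

(** Independence of the homogeneous parts: any homogeneous decomposition of x
    computes its components. *)
Lemma comp_unique (I : eqType) (r : seq I) (d : I -> T) (z : I -> K) x g :
  (forall i, z i \in grade (d i)) -> x = \sum_(i <- r) z i ->
  comp g x = \sum_(i <- r | d i == g) z i.
Proof.
move=> zG xE; have [us fG xF] := projT2 (cid (decomposition x)).
pose f := (projT1 (cid (decomposition x))).2.
pose d' (o : T + I) := match o with inl h => h | inr i => d i end.
pose z' (o : T + I) := match o with inl h => f h | inr i => - z i end.
have zG' o : z' o \in grade (d' o) by case: o => [h|i]; [exact: fG|exact: gradeN].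
have := @grading_component _ _ _ (@gradingP T K) _
  ([seq inl h | h <- supp_seq x] ++ [seq inr i | i <- r]) d' z' g zG'.
rewrite !big_cat !big_map /= !sumrN -xE -xF subrr => /(_ erefl) /eqP.
by rewrite subr_eq0 => /eqP.
Qed.

Lemma comp_is_zmod_morphism g : zmod_morphism (comp g).
Proof.
move=> x y.
pose d (o : T + T) := match o with inl h => h | inr h => h end.
pose z (o : T + T) := match o with inl h => comp h x | inr h => - comp h y end.
have zG o : z o \in grade (d o).
  by case: o => h; [exact: comp_grade|exact/gradeN/comp_grade].
have compx : comp g x = \sum_(h <- supp_seq x | h == g) comp h x.
  by apply: comp_unique; [move=> h; exact: comp_grade|exact: comp_sum].
have compy : comp g y = \sum_(h <- supp_seq y | h == g) comp h y.
  by apply: comp_unique; [move=> h; exact: comp_grade|exact: comp_sum].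
rewrite (comp_unique
  (r := [seq inl h | h <- supp_seq x] ++ [seq inr h | h <- supp_seq y]) g zG).
  by rewrite big_cat !big_map /= sumrN compx compy.
by rewrite big_cat !big_map /= sumrN -!comp_sum.
Qed.
HB.instance Definition _ g :=
  GRing.isZmodMorphism.Build K K (comp g) (comp_is_zmod_morphism g).

Lemma comp_homog g h x : x \in grade h -> comp g x = if h == g then x else 0.
Proof.
move=> xh; rewrite (comp_unique (r := [:: x]) (d := fun y => if y == x then h else g)
  (z := fun y => if y == x then x else 0) g) ?big_seq1 ?eqxx //.
  by rewrite big_mkcond big_seq1 eqxx.
by move=> y; case: ifP => // _; exact: grade0.
Qed.

Lemma compM_homog g h x y : y \in grade h -> comp g (x * y) = comp (g - h) x * y.
Proof.
move=> yh; rewrite (comp_unique (r := supp_seq x) (d := fun k => k + h)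
  (z := fun k => comp k x * y) g).
- rewrite [in RHS](comp_unique (r := supp_seq x) (d := id)
    (z := fun k => comp k x) (x := x)); last exact: comp_sum.
    by rewrite mulr_suml; apply: eq_bigl => k; rewrite -[RHS](inj_eq (addIr h)) subrK.
  by move=> k; exact: comp_grade.
- by move=> k; apply: gradeM yh; exact: comp_grade.
- by rewrite [in LHS](comp_sum x) mulr_suml.
Qed.

Lemma comp_eq0 x : (forall g, comp g x = 0) -> x = 0.
Proof. by move=> c0; rewrite (comp_sum x) big1. Qed.

Lemma comp_supp_seq g x : comp g x != 0 -> g \in supp_seq x.
Proof.
apply: contraNT => gs.
rewrite (comp_unique (r := supp_seq x) (d := id) (z := fun k => comp k x)).
- rewrite big_seq_cond big_pred0 // => h.
  by apply/negP => /andP[hs /eqP hg]; rewrite -hg hs in gs.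
- by move=> k; exact: comp_grade.
- exact: comp_sum.
Qed.

Lemma comp_partial_sum (P : pred T) g x :
  comp g (\sum_(h <- supp_seq x | P h) comp h x) = if P g then comp g x else 0.
Proof.
rewrite raddf_sum /=; under eq_bigr do rewrite (comp_homog _ (comp_grade _ _)).
have [gs|gs] := boolP (g \in supp_seq x); last first.
  have -> : comp g x = 0 by apply/eqP; apply: contraNT gs; exact: comp_supp_seq.
  rewrite if_same.
  rewrite big_seq_cond big1 // => h /andP[hs _].
  by case: eqP => // hg; rewrite -hg hs in gs.
rewrite -big_mkcondr /=; case: ifP => [Pg|nPg]; last first.
  by rewrite big_pred0 // => h; apply/negP => /andP[Ph /eqP hg]; rewrite -hg Ph in nPg.
rewrite -(big_uniq_pred1 (comp^~ x) (supp_seq_uniq x) gs); apply: eq_bigl => h.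
by case: eqP => [->|_]; rewrite ?Pg ?andbF.
Qed.

End Components.

(** * Leading terms *)

Definition group_order (T : zmodType) (le : rel T) : Prop :=
  [/\ reflexive le, antisymmetric le, transitive le, total le
     & forall z, {homo +%R z : x y / le x y}].

Section LeadingTerms.
Variables (T : torsionFreeZmodType) (K : gradedFieldType T) (le : rel T).
Hypothesis leP : group_order le.
Let le_refl : reflexive le. Proof. by case: leP. Qed.
Let le_anti : antisymmetric le. Proof. by case: leP. Qed.
Let le_trans : transitive le. Proof. by case: leP. Qed.
Let le_total : total le. Proof. by case: leP. Qed.
Let leD z : {homo +%R z : x y / le x y}. Proof. by case: leP. Qed.
Implicit Types (g h k : T) (x y : K).

Lemma leBD g h k : le (h + k) g -> le h (g - k).
Proof. by move=> /(leD (- k)); rewrite addrCA addNr addr0 [- k + g]addrC. Qed.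

Definition below h x := forall g, le h g -> comp g x = 0.

Definition lead h x x0 := x0 \in grade h /\ below h (x - x0).

Lemma belowD h x y : below h x -> below h y -> below h (x + y).
Proof. by move=> bx bY g hg; rewrite raddfD /= bx ?bY ?addr0. Qed.

Lemma belowM h k x y : below h x -> (forall g, comp g y != 0 -> le g k) ->
  below (h + k) (x * y).
Proof.
move=> bx by_ g hkg; rewrite (comp_sum y) mulr_sumr raddf_sum /= big1 // => b _.
have [->|nyb] := eqVneq (comp b y) 0; first by rewrite mulr0 raddf0.
rewrite (compM_homog _ _ (comp_grade b y)) bx ?mul0r //; apply: leBD.
apply: le_trans hkg; exact/leD/by_.
Qed.

Lemma below_le h x g : below h x -> comp g x != 0 -> le g h.
Proof.
move=> bx; have [//|/bx->] := orP (le_total g h); by rewrite eqxx.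
Qed.

Lemma homog_le h x g : x \in grade h -> comp g x != 0 -> le g h.
Proof.
by move=> xh; rewrite (comp_homog g xh); case: (eqVneq h g) => [->|]; rewrite ?eqxx.
Qed.

Lemma lead_homog h x : x \in grade h -> lead h x x.
Proof. by split=> // g _; rewrite subrr raddf0. Qed.

Lemma leadM h k x y x0 y0 : lead h x x0 -> lead k y y0 ->
  lead (h + k) (x * y) (x0 * y0).
Proof.
move=> [x0h bx] [y0k bY]; split; first exact: gradeM.
have -> : x * y - x0 * y0 = (x - x0) * (y - y0) + ((x - x0) * y0 + x0 * (y - y0)).
  by rewrite -{1}[x](subrK x0) -{1}[y](subrK y0) mulrDl !mulrDr !addrA addrK.
apply: belowD; first by apply: belowM => // g; exact: below_le.
apply: belowD; first by apply: belowM => // g; exact: homog_le.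
by rewrite mulrC addrC; apply: belowM => // g; exact: homog_le.
Qed.

Lemma leadD h x y x0 y0 : lead h x x0 -> lead h y y0 -> lead h (x + y) (x0 + y0).
Proof.
move=> [x0h bx] [y0k bY]; split; first exact: gradeD.
by rewrite opprD addrACA; apply: belowD.
Qed.

Lemma leadX h x x0 n : lead h x x0 -> lead (h *+ n) (x ^+ n) (x0 ^+ n).
Proof.
move=> lx; elim: n => [|n IHn]; last by rewrite !exprS mulrS; apply: leadM.
by apply: lead_homog; exact: (grading1 gradingP).
Qed.

Lemma lead_sum (I : Type) (r : seq I) h (x x0 : I -> K) :
  (forall i, lead h (x i) (x0 i)) ->
  lead h (\sum_(i <- r) x i) (\sum_(i <- r) x0 i).
Proof.
move=> lx; elim: r => [|i r IHr]; last by rewrite !big_cons; apply: leadD.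
by rewrite !big_nil; apply: lead_homog; exact: grade0.
Qed.

Lemma lead_comp h x x0 : lead h x x0 -> comp h x = x0.
Proof.
move=> [x0h /(_ h (le_refl h)) /eqP].
by rewrite raddfB /= subr_eq0 (comp_homog _ x0h) eqxx => /eqP.
Qed.

Lemma lead_exists x : x != 0 -> exists h, comp h x != 0 /\ lead h x (comp h x).
Proof.
move=> nx; pose s := [seq g <- supp_seq x | comp g x != 0].
have xE : x = \sum_(g <- s) comp g x.
  rewrite big_filter {1}(comp_sum x) [RHS]big_mkcond; apply: eq_bigr => g _.
  by case: eqVneq => [->|].
have s0 : s != [::] by apply: contraNneq nx => s0; rewrite xE s0 big_nil.
have [h hs hmax] := seq_max le_refl le_trans le_total s0.
exists h; split; first by move: hs; rewrite mem_filter => /andP[].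
split=> [|g hg]; first exact: comp_grade.
rewrite raddfB /= (comp_homog g (comp_grade h x)).
have [<-|ng] := eqVneq h g; first by rewrite subrr.
rewrite subr0; apply/eqP/contraT => ng0.
case/eqP: ng; apply: le_anti; rewrite hg hmax // mem_filter ng0.
exact: comp_supp_seq.
Qed.

End LeadingTerms.

(** * Roots of elements of the base in a graded extension *)

Section Extension.
Variables (T : torsionFreeZmodType) (F K : gradedFieldType T).
Variable iota : gradedExt F K.
Implicit Types (g h k : T) (x y w t : K) (a : F).

Definition base : {pred K} := [pred x | `[< exists a, x = iota a >]].

Lemma baseP x : reflect (exists a, x = iota a) (x \in base).
Proof. exact: asboolP. Qed.

Lemma iota_base a : iota a \in base. Proof. by apply/baseP; exists a. Qed.

Lemma base_divring_closed : divring_closed base.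
Proof.
split; first by apply/baseP; exists 1; rewrite rmorph1.
  by move=> x y /baseP[a ->] /baseP[b ->]; rewrite -rmorphB iota_base.
move=> x y /baseP[a ->] /baseP[b ->].
case: (boolP (iota b \is a GRing.unit)) => [ub|/invr_out->]; last first.
  by rewrite -rmorphM iota_base.
by rewrite -rmorphV ?(gradedExt_unit ub) // -rmorphM iota_base.
Qed.
HB.instance Definition _ := GRing.isDivringClosed.Build K base base_divring_closed.

Lemma comp_iota g a : comp g (iota a) = iota (comp g a).
Proof.
rewrite (comp_unique (r := supp_seq a) (d := id) (z := fun h => iota (comp h a))).
- rewrite [in RHS](comp_unique (r := supp_seq a) (d := id)
    (z := fun k => comp k a) (x := a)).
  + by rewrite rmorph_sum.
  + by move=> k; exact: comp_grade.
  + exact: comp_sum.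
- by move=> k; apply: gradedExt_grade; exact: comp_grade.
- by rewrite -rmorph_sum -comp_sum.
Qed.

Lemma comp_base g x : x \in base -> comp g x \in base.
Proof. by case/baseP=> a ->; rewrite comp_iota iota_base. Qed.

Section Roots.
Variable le : rel T.
Hypothesis leP : group_order le.
Variable m : nat.
Hypothesis m_unit : (m%:R : K) \is a GRing.unit.

(** If t has leading term 1 and t ^+ m lies in F, then so does t. Otherwise
    write t = s + u with s the sum of the components of t lying in F, and let
    h be the top degree of u. As t ^+ m - s ^+ m is u times a sum of m products
    with leading term 1, its leading term is m times the component of t of
    degree h, which would then lie in F. *)
Lemma principal_root_base t : lead le 0 t 1 -> t ^+ m \in base -> t \in base.
Proof.
move=> lt1 tm.
pose s := \sum_(g <- supp_seq t | comp g t \in base) comp g t.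
pose u := t - s.
have sB : s \in base by apply: rpred_sum.
have compsE g : comp g s = if comp g t \in base then comp g t else 0.
  by rewrite /s (comp_partial_sum (fun h => comp h t \in base)).
have [/eqP|nu] := eqVneq u 0; first by rewrite subr_eq0 => /eqP->.
have [h [nuh luh]] := lead_exists leP nu.
have compuE : comp h u = if comp h t \in base then 0 else comp h t.
  by rewrite raddfB /= compsE; case: ifP; rewrite ?subrr ?subr0.
have ls1 : lead le 0 s 1.
  split=> [|g g0]; first exact: (grading1 gradingP).
  have := lt1.2 g g0; rewrite !raddfB /= compsE => /eqP.
  rewrite subr_eq0 => /eqP tg; rewrite tg; case: ifP => [_|]; first by rewrite subrr.
  by rewrite comp_base // rpred1.
have lQ : lead le 0 (\sum_(i < m) t ^+ (m.-1 - i) * s ^+ i) (m%:R).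
  have -> : m%:R = \sum_(i < m) (1 ^+ (m.-1 - i) * 1 ^+ i : K).
    by under eq_bigr do rewrite !expr1n mulr1; rewrite sumr_const card_ord.
  apply: lead_sum => // i.
  have := leadM leP (leadX leP (m.-1 - i) lt1)
    (leadX leP i ls1).
  by rewrite !mul0rn addr0.
have := leadM leP luh lQ; rewrite addr0.
have [m0|m_gt0] := posnP m; first by move: m_unit; rewrite m0 unitr0.
rewrite -subrXX => /(lead_comp leP) cE.
have uB : comp h u \in base.
  rewrite -[comp h u](mulrK m_unit) rpred_div ?rpred_nat // -cE comp_base //.
  by rewrite rpredB // rpredX.
by move: nuh uB; rewrite compuE; case: ifP => [|->]; rewrite ?eqxx.
Qed.

(** An m-th root w of an element of F is its leading term up to a factor in F. *)
Lemma homogeneous_root w : w != 0 -> w ^+ m \in base ->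
  exists x b h, [/\ w = b * x, b \in base, x \in grade h, x != 0 & x ^+ m \in base].
Proof.
move=> nw wm; have [h [nx lw]] := lead_exists leP nw.
set x := comp h w in nx lw.
have xh : x \in grade h by exact: comp_grade.
have xm : x ^+ m \in base.
  by rewrite -(lead_comp leP (leadX leP m lw)) comp_base.
exists x, (w / x), h; split=> //; first by rewrite divrK // (grade_unit xh).
apply: principal_root_base; last by rewrite exprMn exprVn rpred_div.
rewrite -(subrr h) -(divrr (grade_unit xh nx)); apply: leadM => //; apply: lead_homog.
exact: grade_inv.
Qed.

End Roots.

Lemma iota_inj : injective iota.
Proof.
apply: raddf_inj => a ia0; apply/comp_eq0 => g; apply/eqP/contraT => nag.
have := rmorph_unit iota (grade_unit (comp_grade g a) nag).
by rewrite -comp_iota ia0 raddf0 unitr0.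
Qed.

Lemma iota_eq0 a : (iota a == 0) = (a == 0).
Proof. by rewrite -(rmorph0 iota) (inj_eq iota_inj). Qed.

(** Dividing P by the largest power of 'X makes its constant coefficient, a
    multiple of q, nonzero. *)
Lemma algebraic_multiple (P : {poly F}) q : P != 0 -> q != 0 ->
  (map_poly iota P).[q] = 0 -> exists q' c, c != 0 /\ q * q' = iota c.
Proof.
move=> nP nq; have [k [Q]] := multiplicity_XsubC P 0.
rewrite nP /= => nQ0 ->; rewrite rmorphM rmorphXn /= map_polyXsubC rmorph0 subr0.
rewrite hornerM hornerXn => /eqP; rewrite mulf_eq0 expf_eq0 (negPf nq) andbF orbF.
have /factor_theorem[R QE] : root (Q - Q.[0]%:P) 0.
  by rewrite /root !hornerE subrr.
have -> : Q = R * 'X + Q.[0]%:P by rewrite -[in 'X](subr0 'X) -polyC0 -QE subrK.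
rewrite rmorphD rmorphM /= map_polyX map_polyC hornerD hornerMX hornerC addr_eq0.
move=> /eqP e; exists (- (map_poly iota R).[q]), Q.[0].
by split=> //; rewrite mulrN mulrC e opprK.
Qed.

(** The matrix of the multiplication by q in a basis of K over F has q as an
    eigenvalue, so q is integral over F. *)
Lemma finite_dim_integral q : finite_dim iota ->
  exists2 P : {poly F}, P \is monic & (map_poly iota P).[q] = 0.
Proof.
move=> [n [b bP]].
have coords x : exists c : {ffun 'I_n -> F}, x = \sum_i iota (c i) * b i.
  by have [c [cE _]] := bP x; exists c.
have /choice[c cE] : forall i, exists c : {ffun 'I_n -> F},
    q * b i = \sum_j iota (c j) * b j.
  by move=> i; exact: coords.
pose A : 'M[F]_n := \matrix_(i, j) c j i.
pose f : {rmorphism F -> {fraction K}} := @FracField.tofrac K \o iota.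
pose v : 'rV[{fraction K}]_n := \row_j FracField.tofrac (b j).
have vA : v *m map_mx f A = FracField.tofrac q *: v.
  apply/rowP=> i; rewrite !mxE -rmorphM cE rmorph_sum; apply: eq_bigr => j _.
  by rewrite !mxE /= -rmorphM mulrC.
have nv : v != 0.
  apply: contraNneq (oner_neq0 K) => v0; have [e ->] := coords 1.
  rewrite big1 // => j _; apply/eqP; rewrite mulf_eq0 -(tofrac_eq0 (b j)).
  by move/rowP/(_ j): v0; rewrite !mxE => ->; rewrite eqxx orbT.
exists (char_poly A); first exact: char_poly_monic.
have : root (char_poly (map_mx f A)) (FracField.tofrac q).
  by rewrite -eigenvalue_root_char; apply/eigenvalueP; exists v.
rewrite -map_char_poly /root map_poly_comp horner_map /= tofrac_eq0.
by move/eqP.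
Qed.

Lemma base_multiple q : finite_dim iota -> q != 0 ->
  exists q' c, c != 0 /\ q * q' = iota c.
Proof.
move=> fK nq; have [P mP Pq] := finite_dim_integral q fK.
exact: algebraic_multiple (monic_neq0 mP) nq Pq.
Qed.

End Extension.

(** * Kummer theory of fields *)

Section EigenDecomposition.
Variables (k : fieldType) (V : lmodType k) (m : nat) (z : k).
Hypothesis zP : m.-primitive_root z.
Variable s : {linear V -> V}.
Hypothesis sm : forall y, iter m s y = y.

(** The projection onto the eigenspace of s for z^-i along the other ones. *)
Definition eigenproj (i : nat) (y : V) : V :=
  m%:R^-1 *: \sum_(j < m) z ^+ (i * j) *: iter j s y.

Let m_gt0 : (0 < m)%N := prim_order_gt0 zP.

Lemma linear_iter (t : {linear V -> V}) j (y : V) :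
  (forall x, t (s x) = s (t x)) -> t (iter j s y) = iter j s (t y).
Proof. by move=> ts; elim: j => //= j IHj; rewrite ts IHj. Qed.

Lemma iterZ j (a : k) (y : V) : iter j s (a *: y) = a *: iter j s y.
Proof. by elim: j => //= j ->; rewrite linearZ. Qed.

Lemma eigenproj_eigen i y : s (eigenproj i y) = z ^- i *: eigenproj i y.
Proof.
have zi0 : z ^+ i != 0 by rewrite expf_neq0 // (prim_root_eq0 zP) -lt0n.
apply: (canRL (scalerK zi0)); rewrite /eigenproj linearZ /= scalerA mulrC -scalerA.
congr (_ *: _); rewrite linear_sum scaler_sumr /=.
pose f j := z ^+ (i * j) *: iter j s y.
transitivity (\sum_(j < m) f j.+1).
  by apply: eq_bigr => j _; rewrite linearZ scalerA -exprD -mulnS.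
have fm : f m = f 0%N by rewrite /f sm mulnC exprM (prim_expr_order zP) expr1n muln0.
case: m m_gt0 fm => // n _ fm; rewrite big_ord_recr /= fm addrC.
by rewrite [RHS]big_ord_recl.
Qed.

Lemma sum_eigenproj y : \sum_(i < m) eigenproj i y = y.
Proof.
rewrite /eigenproj -scaler_sumr exchange_big /=.
have mn0 := prim_root_natf_neq0 zP.
apply: (canLR (scalerK mn0)).
rewrite (bigD1 (Ordinal m_gt0)) //= [X in _ + X]big1 ?addr0; last first.
  move=> j nj; rewrite -scaler_suml; apply/eqP; rewrite scaler_eq0; apply/orP; left.
  have zj : z ^+ j - 1 != 0.
    rewrite subr_eq0 -(prim_order_dvd zP) gtnNdvd //.
    by rewrite lt0n; apply: contraNneq nj => j0; apply/eqP/val_inj.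
  apply/eqP/(mulfI zj); rewrite mulr0.
  under eq_bigr do rewrite mulnC exprM.
  by rewrite -subrX1 exprAC (prim_expr_order zP) expr1n subrr.
under eq_bigr do rewrite muln0 expr0 scale1r.
by rewrite sumr_const card_ord scaler_nat.
Qed.

Lemma eigenproj_commute (t : {linear V -> V}) a i y :
  (forall x, t (s x) = s (t x)) -> t y = a *: y ->
  t (eigenproj i y) = a *: eigenproj i y.
Proof.
move=> ts ty; rewrite /eigenproj linearZ linear_sum /= scalerA mulrC -scalerA.
congr (_ *: _); rewrite scaler_sumr; apply: eq_bigr => j _.
by rewrite linearZ /= linear_iter // ty iterZ !scalerA mulrC.
Qed.

End EigenDecomposition.

Section KummerTheory.
Variables (k : fieldType) (L : splittingFieldType k) (m : nat) (z : k).
Hypothesis zP : m.-primitive_root z.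
Local Notation G := ('Gal({:L} / 1))%g.

Lemma gal_expE (s : gal_of {:L}) n (y : L) : (s ^+ n)%g y = iter n s y.
Proof.
elim: n => [|n IHn]; first by rewrite expg0 gal_id.
by rewrite expgSr galM ?memvf // IHn.
Qed.

Lemma gal_base (s : gal_of {:L}) (a : k) : s (a%:A) = a%:A.
Proof. by rewrite linearZ /= rmorph1. Qed.

(** Splitting y by the eigenprojections of one automorphism after the other
    works because the projections for s preserve the eigenvectors of the
    automorphisms commuting with s. *)
Lemma commuting_gal_eigen (gs : seq (gal_of {:L})) (y : L) :
  {in gs &, forall s t, (s * t = t * s)%g} -> {in gs, forall s, s ^+ m = 1}%g ->
  exists2 ys : seq L, y = \sum_(x <- ys) x &
    {in ys & gs, forall x (s : gal_of _), exists2 c : k, c ^+ m = 1 & s x = c *: x}.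
Proof.
elim: gs => [|s gs IHgs] gsC gsm.
  by exists [:: y]; rewrite ?big_seq1.
have [||ys yE ysP] := IHgs.
- by move=> u v us vs; apply: gsC; rewrite inE ?us ?vs orbT.
- by move=> u us; apply: gsm; rewrite inE us orbT.
have sm x : iter m s x = x by rewrite -gal_expE gsm ?mem_head ?gal_id.
exists [seq eigenproj m z s i x | x <- ys, i <- iota 0 m].
  rewrite big_allpairs_dep yE; apply: eq_bigr => x _ /=.
  rewrite -[LHS](sum_eigenproj zP s x).
  by rewrite -(big_mkord xpredT (fun i => eigenproj m z s i x)) /index_iota subn0.
move=> _ t /allpairsP[[x i] /= [xs im ->]]; rewrite inE => /orP[/eqP->|tgs].
  exists (z ^- i); first by rewrite exprVn exprAC (prim_expr_order zP) expr1n invr1.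
  exact: (eigenproj_eigen zP sm).
have [c cm tx] := ysP _ _ xs tgs; exists c => //.
apply: eigenproj_commute => // x'.
have := gsC t s; rewrite !inE tgs eqxx orbT => /(_ isT isT).
move=> /(congr1 (fun u : gal_of _ => u x')).
by rewrite !galM ?memvf.
Qed.

(** Elements of an abelian extension of exponent dividing m are sums of
    m-th roots of elements of the base field: the automorphisms are
    simultaneously diagonalizable, and the m-th power of a common eigenvector is
    fixed by all of them. *)
Lemma kummer_decomposition (y : L) :
  galois 1 {:L} -> abelian G -> (exponent G %| m)%N ->
  exists2 ys : seq L, y = \sum_(x <- ys) x &
    {in ys, forall x, exists a : k, x ^+ m = a%:A}.
Proof.
move=> galL abG expG.
have [||ys yE ysP] := @commuting_gal_eigen (enum G) y.
- by move=> s t; rewrite !mem_enum => sG tG; exact: (centsP abG).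
- by move=> s; rewrite mem_enum => sG; exact: (exponentP expG).
exists ys => // x xs; have /vlineP[a aE] : x ^+ m \in 1%VS; last by exists a.
have /galois_fixedField <- := galL; apply/fixedFieldP; first exact: memvf.
move=> s sG; have [|c cm sx] := ysP x s xs; first by rewrite mem_enum.
by rewrite rmorphXn /= sx exprZn cm scale1r.
Qed.

(** For nonzero x the quotient s x / x is an m-th root of unity, hence lies in k and is fixed
    by s, which gives the action of all the powers of s. *)
Lemma kummer_eigen (s : gal_of {:L}) (x : L) a : x ^+ m = a%:A ->
  exists c : k, c ^+ m = 1 /\ forall n, (s ^+ n)%g x = c ^+ n *: x.
Proof.
move=> xm; have [->|nx] := eqVneq x 0.
  by exists 1; split=> [|n]; rewrite ?expr1n // scaler0 rmorph0.
have zL : m.-primitive_root (z%:A : L) by rewrite (fmorph_primitive_root (in_alg L)).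
have /(prim_rootP zL)[j sj] : (s x / x) ^+ m = 1.
  by rewrite expr_div_n -rmorphXn /= xm gal_base divff // -xm expf_neq0.
exists (z ^+ j); split; first by rewrite exprAC (prim_expr_order zP) expr1n.
have sx : s x = z ^+ j *: x.
  by rewrite -[LHS](divfK nx) sj -(rmorphXn (in_alg L)) /= mulr_algl.
elim=> [|n IHn]; first by rewrite gal_id scale1r.
by rewrite gal_expE /= -gal_expE IHn linearZ /= sx scalerA -exprSr.
Qed.

End KummerTheory.

(** * Galois models *)

Section GaloisModels.
Variables (k E : fieldType) (i : k -> E).

Lemma model_isoZ (M : galoisModel i) a (x : M) :
  model_iso M (a *: x) = i a * model_iso M x.
Proof. by rewrite -mulr_algl rmorphM model_base. Qed.

Lemma model_iso_inj (M : galoisModel i) : injective (model_iso M).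
Proof. exact/bij_inj/model_bij. Qed.

Lemma model_iso_surj (M : galoisModel i) y : exists x : M, model_iso M x = y.
Proof. by have [g _ gK] := model_bij M; exists (g y). Qed.

(** Conjugation by the isomorphism between two models. *)
Lemma model_transport (M1 M2 : galoisModel i) (s : gal_of {:M1}) :
  exists2 t : gal_of {:M2}, t \in 'Gal({:M2} / 1)%g &
    forall x1 x2, model_iso M1 x1 = model_iso M2 x2 ->
      model_iso M1 (s x1) = model_iso M2 (t x2).
Proof.
have [g1 g1K K1g] := model_bij M1; have [g2 g2K K2g] := model_bij M2.
pose h (x : M2) : M2 := g2 (model_iso M1 (s (g1 (model_iso M2 x)))).
have hE x : model_iso M2 (h x) = model_iso M1 (s (g1 (model_iso M2 x))) by rewrite K2g.
have h_lin : linear h.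
  move=> a x y; apply: (@model_iso_inj M2).
  rewrite rmorphD model_isoZ !hE -model_isoZ -rmorphD -linearP.
  congr (model_iso M1 (s _)).
  by apply: (@model_iso_inj M1); rewrite K1g !rmorphD !model_isoZ !K1g.
pose hL : {linear M2 -> M2} := HB.pack h (GRing.isLinear.Build _ _ _ _ h h_lin).
have : kAut 1 {:M2} (linfun hL).
  rewrite kAutfE; apply/kHom_monoid_morphism; split=> [|x y]; rewrite !lfunE /=;
    apply: (@model_iso_inj M2).
    have g11 : g1 (model_iso M2 1) = 1.
      by apply: (@model_iso_inj M1); rewrite K1g !rmorph1.
    by rewrite hE g11 !rmorph1.
  have g1M : g1 (model_iso M2 (x * y)) = g1 (model_iso M2 x) * g1 (model_iso M2 y).
    by apply: (@model_iso_inj M1); rewrite K1g !rmorphM !K1g.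
  by rewrite hE g1M !rmorphM -!hE.
move=> /kAut_to_gal[t tG tE]; exists t => // x1 x2 x12.
by rewrite -tE ?memvf // lfunE /= hE -x12 g1K.
Qed.

(** The definitions of the Galois exponent and of abelian extensions each pick
    a model; commutativity is independent of that choice. *)
Lemma model_gal_comm (M1 M2 : galoisModel i) :
  abelian 'Gal({:M2} / 1) -> abelian 'Gal({:M1} / 1).
Proof.
move=> /centsP ab2; apply/centsP=> s _ t _; apply/eqP/gal_eqP => x _.
have [s' s'G s'E] := model_transport M2 s; have [t' t'G t'E] := model_transport M2 t.
have [x' x'E] := model_iso_surj M2 (model_iso M1 x).
apply: (@model_iso_inj M1); rewrite !galM ?memvf //.
rewrite (t'E _ _ (s'E _ _ (esym x'E))) (s'E _ _ (t'E _ _ (esym x'E))).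
by rewrite -!galM ?memvf // ab2.
Qed.

Lemma gal_exponentP (M0 : galoisModel i) :
  exists M : galoisModel i, gal_exponent i = exponent 'Gal({:M} / 1).
Proof.
apply: (@classical_sets.xgetPex _ 0%N
  (fun n => exists M : galoisModel i, n = exponent 'Gal({:M} / 1))).
by exists (exponent 'Gal({:M0} / 1)), M0.
Qed.

Variables (m : nat) (z : k).
Hypothesis zP : m.-primitive_root z.

Lemma model_root (M : galoisModel i) (x : M) a :
  (model_iso M x) ^+ m = i a -> x ^+ m = a%:A.
Proof.
by move=> xm; apply: (@model_iso_inj M); rewrite rmorphXn model_base.
Qed.

(** The m-th power of an automorphism fixes all the m-th roots of elements of k,
    which span E. *)
Lemma model_exponent_dvd (M : galoisModel i) :
  (forall y : E, exists2 ys : seq E, y = \sum_(x <- ys) x &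
     {in ys, forall x, exists a, x ^+ m = i a}) ->
  (exponent 'Gal({:M} / 1) %| m)%N.
Proof.
move=> spanE; have [g gK Kg] := model_bij M.
apply/exponentP => s sG; apply/eqP/gal_eqP => x _; rewrite gal_id.
have [ys yE ysP] := spanE (model_iso M x).
have -> : x = \sum_(y <- ys) g y.
  apply: (@model_iso_inj M); rewrite yE rmorph_sum.
  by apply: eq_bigr => y _; rewrite Kg.
rewrite rmorph_sum big_seq [RHS]big_seq; apply: eq_bigr => y yin.
have [a ya] := ysP y yin.
have gy : g y ^+ m = a%:A by apply: model_root; rewrite Kg.
have [c [cm /(_ m)]] := kummer_eigen zP s gy; rewrite cm scale1r; exact.
Qed.

(** With e the exponent and s y = c y, applying s^e = 1 to y shows c^e y = y, so
    s fixes y^e. *)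
Lemma model_root_exponent (M : galoisModel i) (y : E) a : y ^+ m = i a ->
  exists b, y ^+ exponent 'Gal({:M} / 1) = i b.
Proof.
move=> ym; have [x xE] := model_iso_surj M y; rewrite -xE in ym *.
have xm := model_root ym; set e := exponent _.
suff /vlineP[b bE] : x ^+ e \in 1%VS by exists b; rewrite -rmorphXn bE model_base.
have /galois_fixedField <- := model_galois M; apply/fixedFieldP; first exact: memvf.
move=> s sG; have [c [cm sx]] := kummer_eigen zP s xm.
have := sx e; rewrite (exponentP (dvdnn _) s sG) gal_id => xc.
have := sx 1%N; rewrite expg1 expr1 rmorphXn /= => ->.
rewrite exprZn.
have e_gt0 : (0 < e)%N by exact: exponent_gt0.
have -> : x ^+ e = x * x ^+ e.-1 by rewrite -exprS prednK.
by rewrite scalerAl -xc.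
Qed.

End GaloisModels.

Section FiniteDimension.
Variables (k : fieldType) (V : lmodType k).

(** A spanning family of the least possible size is free. *)
Lemma span_vector_axiom (n0 : nat) (b0 : 'I_n0 -> V) :
  (forall y, exists c : 'I_n0 -> k, y = \sum_j c j *: b0 j) ->
  exists n, inhabited (Vector.axiom n V).
Proof.
move=> span0.
pose spans n := `[< exists b : 'I_n -> V,
  forall y, exists c : 'I_n -> k, y = \sum_j c j *: b j >].
have ex_spans : exists n, spans n by exists n0; apply/asboolP; exists b0.
have [n /asboolP[b bspan] nmin] := ex_minnP ex_spans.
have bfree (c : 'I_n -> k) : \sum_j c j *: b j = 0 -> forall j, c j = 0.
  move=> c0 j0; apply/eqP; case: (eqVneq (c j0) 0) => // ncj.
  move: b bspan nmin c j0 c0 ncj; case: n => [|n] b bspan nmin c j0 c0 ncj.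
    by case: (j0).
  suff /nmin : spans n by rewrite ltnn.
  apply/asboolP; exists (fun j => b (lift j0 j)) => y; have [d ->] := bspan y.
  exists (fun j => d (lift j0 j) - d j0 * ((c j0)^-1 * c (lift j0 j))).
  rewrite (bigD1_ord j0) //=; move: c0; rewrite (bigD1_ord j0) //= => /eqP.
  rewrite addr_eq0 => /eqP/(canRL (scalerK ncj)) ->.
  rewrite !scalerN !scaler_sumr -sumrN -big_split /=.
  by apply: eq_bigr => j _; rewrite scalerBl addrC !scalerA !mulrA.
have /choice[v2r v2rK] : forall y, exists c : 'rV[k]_n, y = \sum_j c 0 j *: b j.
  move=> y; have [c ->] := bspan y; exists (\row_j c j).
  by apply: eq_bigr => j _; rewrite mxE.
have inj (c d : 'rV[k]_n) : \sum_j c 0 j *: b j = \sum_j d 0 j *: b j -> c = d.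
  move=> /eqP; rewrite -subr_eq0 -sumrB => /eqP cd; apply/rowP => j; apply/eqP.
  rewrite -subr_eq0; apply/eqP; apply: (bfree (fun j => c 0 j - d 0 j)).
  by rewrite -[RHS]cd; apply: eq_bigr => j' _; rewrite scalerBl.
exists n; split; exists v2r.
  move=> a x y; apply: inj; rewrite -v2rK {1}[x]v2rK {1}[y]v2rK scaler_sumr.
  by rewrite -big_split; apply: eq_bigr => j _; rewrite !mxE scalerDl scalerA.
exists (fun c : 'rV_n => \sum_j c 0 j *: b j) => [y|c]; first by rewrite -v2rK.
by apply: inj; rewrite -v2rK.
Qed.

End FiniteDimension.

Section KummerSplitting.
Variables (k : fieldType) (m : nat) (z : k).
Hypothesis zP : m.-primitive_root z.

Section Split.
Variables (L : fieldExtType k) (n : nat) (b : 'I_n -> L).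
Hypothesis bspan : forall y, exists c : 'I_n -> k, y = \sum_j c j *: b j.
Hypothesis bm : forall j, exists a : k, (b j) ^+ m = a%:A.

Let bs : seq L := [seq y <- [seq b j | j <- enum 'I_n] | y != 0].
Let rts (y : L) : seq L := [seq (z%:A) ^+ j * y | j <- iota 0 m].

Let m_gt0 : (0 < m)%N := prim_order_gt0 zP.

Lemma kummer_generators (rs : seq L) : {subset bs <= rs} -> <<1 & rs>>%VS = {:L}%VS.
Proof.
move=> bsrs; apply/eqP; rewrite eqEsubv subvf; apply/subvP => y _.
have [c ->] := bspan y; apply: rpred_sum => j _; apply: rpredZ.
have [->|nb] := eqVneq (b j) 0; first exact: rpred0.
by apply/seqv_sub_adjoin/bsrs; rewrite mem_filter nb map_f ?mem_enum.
Qed.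

Lemma kummer_roots_uniq y : y != 0 -> uniq (rts y).
Proof.
move=> ny; rewrite map_inj_in_uniq ?iota_uniq // => j j'.
rewrite !mem_iota !add0n => /andP[_ jm] /andP[_ jm'] /(mulIf ny) /eqP.
have zL : m.-primitive_root (z%:A : L) by rewrite (fmorph_primitive_root (in_alg L)).
by rewrite (eq_prim_root_expr zL) !modn_small // => /eqP.
Qed.

Lemma kummer_factor y : y != 0 ->
  'X^m - (y ^+ m)%:P %= \prod_(x <- rts y) ('X - x%:P).
Proof.
move=> ny; have sz := size_XnsubC (y ^+ m) m_gt0.
suff -> : 'X^m - (y ^+ m)%:P =
    lead_coef ('X^m - (y ^+ m)%:P) *: \prod_(x <- rts y) ('X - x%:P).
  by rewrite eqp_scale // lead_coef_eq0 -size_poly_eq0 sz.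
apply: all_roots_prod_XsubC.
- by rewrite sz size_map size_iota.
- apply/allP => _ /mapP[j _ ->]; rewrite /root !hornerE exprMn.
  rewrite exprAC -(rmorphXn (in_alg L)) /= (prim_expr_order zP) scale1r expr1n.
  by rewrite mul1r subrr.
- by rewrite uniq_rootsE kummer_roots_uniq.
Qed.

Lemma kummer_poly_base y : y \in bs -> 'X^m - (y ^+ m)%:P \is a polyOver 1%VS.
Proof.
rewrite mem_filter => /andP[_ /mapP[j _ ->]].
rewrite rpredB ?rpredX ?polyOverX // polyOverC.
by have [a ->] := bm j; apply/vlineP; exists a.
Qed.

(** With m-th roots of unity in k, an extension spanned by m-th roots y of
    elements of k is the splitting field of the product of the X^m - y^m, which
    are separable for nonzero y. *)
Lemma kummer_splitting : SplittingField.axiom L.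
Proof.
exists (\prod_(y <- bs) ('X^m - (y ^+ m)%:P)).
  by rewrite big_seq; apply: rpred_prod => y; exact: kummer_poly_base.
exists (flatten [seq rts y | y <- bs]).
  have: all (fun y => y != 0) bs by exact: filter_all.
  elim: bs => [|y s IHs] /=; first by rewrite !big_nil eqpxx.
  case/andP=> ny /IHs e; rewrite big_cons big_cat.
  exact: eqp_trans (eqp_mulr _ (kummer_factor ny)) (eqp_mull _ e).
apply: kummer_generators => y ybs; apply/flatten_mapP; exists y => //.
by apply/mapP; exists 0%N; rewrite ?mem_iota // expr0 mul1r.
Qed.

Lemma kummer_separable y : y \in bs -> separable_element 1 y.
Proof.
move=> ybs; have ny : y != 0 by move: ybs; rewrite mem_filter => /andP[].
apply/separable_elementP; exists ('X^m - (y ^+ m)%:P).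
rewrite kummer_poly_base // (eqp_separable (kummer_factor ny)).
by rewrite separable_prod_XsubC kummer_roots_uniq // /root !hornerE subrr.
Qed.

End Split.

Lemma kummer_galois (L : splittingFieldType k) (n : nat) (b : 'I_n -> L) :
  (forall y, exists c : 'I_n -> k, y = \sum_j c j *: b j) ->
  (forall j, exists a : k, (b j) ^+ m = a%:A) -> galois 1 {:L}.
Proof.
move=> bspan bm; apply/and3P; split; [exact: subvf| |exact: normalFieldf].
rewrite -(kummer_generators bspan (fun y ys => ys)); apply: separable_Fadjoin_seq.
by apply/allP => y; exact: kummer_separable bm _.
Qed.

End KummerSplitting.

Section ExtensionAlgebra.
Variables (k E : fieldType) (i : {rmorphism k -> E}).

(** A copy of E on which the k-algebra structure given by i can be declared. *)
Definition ext_algebra : Type := let _ := i in E.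
HB.instance Definition _ := GRing.Field.on ext_algebra.

Definition ext_scale (a : k) (x : ext_algebra) : ext_algebra := (i a : E) * (x : E).

Lemma ext_scaleA a b x : ext_scale a (ext_scale b x) = ext_scale (a * b) x.
Proof. by rewrite /ext_scale rmorphM mulrA. Qed.
Lemma ext_scale1 : left_id 1 ext_scale.
Proof. by move=> x; rewrite /ext_scale rmorph1 mul1r. Qed.
Lemma ext_scaleDr : right_distributive ext_scale +%R.
Proof. by move=> a x y; rewrite /ext_scale mulrDr. Qed.
Lemma ext_scaleDl x : {morph ext_scale^~ x : a b / a + b}.
Proof. by move=> a b; rewrite /ext_scale rmorphD mulrDl. Qed.
HB.instance Definition _ := GRing.Zmodule_isLmodule.Build k ext_algebra
  ext_scaleA ext_scale1 ext_scaleDr ext_scaleDl.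

Lemma ext_scaleAl (a : k) (x y : ext_algebra) : a *: (x * y) = (a *: x) * y.
Proof. exact: mulrA. Qed.
HB.instance Definition _ := GRing.Lmodule_isLalgebra.Build k ext_algebra ext_scaleAl.
Lemma ext_scaleAr (a : k) (x y : ext_algebra) : a *: (x * y) = x * (a *: y).
Proof. exact: mulrCA. Qed.
HB.instance Definition _ := GRing.Lalgebra_isAlgebra.Build k ext_algebra ext_scaleAr.

Lemma ext_algE (a : k) : (a%:A : ext_algebra) = i a.
Proof. exact: mulr1. Qed.


(** The field E itself, with the algebra structure given by i, is a model. *)
Lemma kummer_model (m : nat) (z : k) (n : nat) (b : 'I_n -> E) :
  m.-primitive_root z ->
  (forall y, exists c : 'I_n -> k, y = \sum_j i (c j) * b j) ->
  (forall j, exists a, (b j) ^+ m = i a) ->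
  inhabited (galoisModel i).
Proof.
move=> zP bspan bm.
have [d [vax]] := @span_vector_axiom k ext_algebra n b bspan.
pose L : fieldExtType k :=
  HB.pack ext_algebra (Lmodule_hasFinDim.Build k ext_algebra vax).
pose bL j : L := b j.
have bLspan y : exists c : 'I_n -> k, y = \sum_j c j *: bL j := bspan y.
have bLm j : exists a : k, bL j ^+ m = a%:A.
  by have [a ba] := bm j; exists a; rewrite [RHS]ext_algE -ba.
have splitL := kummer_splitting zP bLspan bLm.
pose M : splittingFieldType k :=
  HB.pack L (FieldExt_isSplittingField.Build k L splitL).
have galM : galois 1 {:M} := kummer_galois (L := M) zP bLspan bLm.
pose f : {rmorphism M -> E} := idfun.
have f_bij : bijective f by exists id.
by split; apply: (@GaloisModel _ _ _ M f f_bij _ galM); exact: ext_algE.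
Qed.

End ExtensionAlgebra.

(** * Graded Kummer theory *)

Section FractionField.
Variables (T : torsionFreeZmodType) (F K : gradedFieldType T).
Variable iota : gradedExt F K.
Local Notation "x %:F" := (FracField.tofrac x).
Local Notation "\d_ u" := (frac (generic_quotient.repr u)).2 (at level 8, u at level 2).
Local Notation "\n_ u" := (frac (generic_quotient.repr u)).1 (at level 8, u at level 2).

Lemma frac_denom_neq0 (R : idomainType) (u : {fraction R}) : \d_u != 0.
Proof. exact: denom_ratioP. Qed.

Lemma frac_numden (R : idomainType) (u : {fraction R}) : u * (\d_u)%:F = (\n_u)%:F.
Proof.
rewrite -{1}[u]reprK !piE; apply/eqP; rewrite piE FracField.equivfE /FracField.mulf.
have d0 := denom_ratioP (generic_quotient.repr u).
by rewrite !numden_Ratio ?mulr1 ?mulf_neq0 ?oner_neq0 // mulrC.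
Qed.

(** Besides a multiple in F of the denominator of u, the factor c contains the
    denominator d of q = n/d, so that the m-th power of the numerator involves
    d^m (n/d) = d^(m-1) n, which is in F. *)
Lemma frac_root_numerator (m : nat) (u : {fraction K}) (q : {fraction F}) :
  finite_dim iota -> (0 < m)%N -> u ^+ m = frac_ext iota q ->
  exists c w, [/\ c != 0, (iota c)%:F * u = w%:F & w ^+ m \in base iota].
Proof.
move=> fK m_gt0 um.
have [r [c [nc rc]]] := base_multiple fK (frac_denom_neq0 u).
have nd := frac_denom_neq0 q; set d := \d_q in nd.
pose w := iota d * (r * \n_u).
have wE : (iota (d * c))%:F * u = w%:F.
  rewrite rmorphM !tofracM -frac_numden -rc tofracM -mulrA; congr (_ * _).
  by rewrite [X in X * u]mulrC -mulrA [u * _]mulrC.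
exists (d * c), w; split=> //; first exact: mulf_neq0.
apply/baseP; exists (d ^+ m.-1 * \n_q * c ^+ m); apply/eqP; rewrite -tofrac_eq.
rewrite tofracXn -wE exprMn um /frac_ext -/d -tofracXn -rmorphXn /=.
have ni : (iota d)%:F != 0 by rewrite tofrac_eq0 iota_eq0.
rewrite mulrA; apply/eqP/(canLR (mulfK ni)); rewrite -!tofracM -!rmorphM exprMn.
rewrite -{1}(prednK m_gt0) exprSr; congr (_%:F); congr (iota _).
by rewrite [LHS]mulrAC [RHS]mulrAC; congr (_ * _); rewrite mulrAC.
Qed.

Lemma frac_sum_numerators (m : nat) (us : seq {fraction K}) :
  finite_dim iota -> (0 < m)%N ->
  {in us, forall u, exists q, u ^+ m = frac_ext iota q} ->
  exists c (ws : seq K), [/\ c != 0,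
    (iota c)%:F * \sum_(u <- us) u = (\sum_(w <- ws) w)%:F &
    {in ws, forall w, w ^+ m \in base iota}].
Proof.
move=> fK m_gt0; elim: us => [_|u us IHus usP].
  by exists 1, [::]; rewrite !big_nil mulr0 tofrac0 oner_neq0.
have [q uq] := usP u (mem_head u us).
have [c1 [w [nc1 wE wm]]] := frac_root_numerator fK m_gt0 uq.
have [|c2 [ws [nc2 wsE wsm]]] := IHus.
  by move=> v vus; apply: usP; rewrite inE vus orbT.
exists (c1 * c2), (iota c2 * w :: [seq iota c1 * w | w <- ws]); split.
- exact: mulf_neq0.
- rewrite !big_cons big_map -mulr_sumr rmorphM tofracD !tofracM -wsE -wE mulrDr.
  by congr (_ + _); rewrite !mulrA // [X in X * u]mulrC.
- have mbase c v : v ^+ m \in base iota -> (iota c * v) ^+ m \in base iota.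
    by move=> vm; rewrite exprMn rpredM // rpredX // iota_base.
  move=> v; rewrite inE => /orP[/eqP->|/mapP[v' v'ws ->]]; apply: mbase => //.
  exact: wsm.
Qed.

End FractionField.

Section KummerGraded.
Variables (T : torsionFreeZmodType) (F K : gradedFieldType T).
Variable iota : gradedExt F K.
Local Notation "x %:F" := (FracField.tofrac x).

(** By homogeneous_root w is x b with x a homogeneous m-th root and b in F, so
    its components are products of x with components of b. *)
Lemma comp_root (m : nat) (w : K) g : (m%:R : K) \is a GRing.unit ->
  w ^+ m \in base iota -> comp g w ^+ m \in base iota.
Proof.
move=> um wm; have [->|nw] := eqVneq w 0.
  have [->|m0] := posnP m; first by rewrite expr0 rpred1.
  by rewrite raddf0 expr0n gtn_eqF // rpred0.
have [le leP] := torsion_free_order T.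
have [x [b [h [-> bB xh _ xm]]]] := homogeneous_root leP um nw wm.
by rewrite (compM_homog _ _ xh) exprMn rpredM // rpredX // comp_base.
Qed.

Hypothesis kummerK : kummer_graded iota.
Let m := graded_exponent iota.
Let fK : finite_dim iota := kummerK.1.1.

Lemma graded_root_of_unity : exists z : deg0 F, m.-primitive_root z.
Proof. exact: kummerK.2. Qed.

Lemma graded_exponent_gt0 : (0 < m)%N.
Proof. by have [z /prim_order_gt0] := graded_root_of_unity. Qed.

Lemma frac_root_of_unity : exists z : {fraction F}, m.-primitive_root z.
Proof.
have [z zP] := graded_root_of_unity.
exists (val z)%:F.
have := fmorph_primitive_root (@FracField.tofrac F \o (val : deg0 F -> F)) m z.
by rewrite zP.
Qed.

Lemma deg0_natr (R : gradedFieldType T) n : val (n%:R : deg0 R) = n%:R.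
Proof. exact: rmorph_nat. Qed.

Lemma graded_exponent_unit : (m%:R : K) \is a GRing.unit.
Proof.
have [z zP] := graded_root_of_unity.
apply: (grade_unit (g := 0)); first by rewrite -deg0_natr (valP (m%:R : deg0 K)).
rewrite -(rmorph_nat iota) iota_eq0 -deg0_natr.
by have := prim_root_natf_neq0 zP; rewrite -(inj_eq val_inj).
Qed.

Lemma frac_kummer_decomposition (u : {fraction K}) :
  exists2 us : seq {fraction K}, u = \sum_(v <- us) v &
    {in us, forall v, exists q, v ^+ m = frac_ext iota q}.
Proof.
have [M0 abM0] := kummerK.1.2.
have [M mE] : exists M : galoisModel (frac_ext iota), m = exponent 'Gal({: M} / 1).
  exact: gal_exponentP M0.
have [z zP] := frac_root_of_unity; have [x <-] := model_iso_surj M u.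
have [|xs xE xsP] := kummer_decomposition zP x (model_galois M) (model_gal_comm M abM0).
  by rewrite -mE.
exists [seq model_iso M y | y <- xs]; first by rewrite big_map xE rmorph_sum.
move=> _ /mapP[y /xsP[q yq] ->]; exists q.
by rewrite -rmorphXn yq model_base.
Qed.

(** Homogeneous elements of K are sums of m-th roots of elements of F that are
    homogeneous of the same degree. *)
Lemma graded_kummer_decomposition g (y : K) : y \in grade g ->
  exists2 ys : seq K, y = \sum_(x <- ys) x &
    {in ys, forall x, x \in grade g /\ x ^+ m \in base iota}.
Proof.
move=> yg; have [us yE usP] := frac_kummer_decomposition y%:F.
have [c [ws [nc wsE wsP]]] := frac_sum_numerators fK graded_exponent_gt0 usP.
have cy : iota c * y = \sum_(w <- ws) w.
  by apply/eqP; rewrite -tofrac_eq tofracM -wsE -yE.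
have [h nch] : exists h, comp h c != 0.
  by apply: contrapT => n; case/eqP: nc; apply: comp_eq0 => h;
     apply/eqP/contraT => nh; case: n; exists h.
have ch := comp_grade h c; have uch := grade_unit ch nch.
have uich : iota (comp h c) \is a GRing.unit by exact: rmorph_unit.
exists [seq iota (comp h c)^-1 * comp (h + g) w | w <- ws].
  have e : \sum_(w <- ws) comp (h + g) w = iota (comp h c) * y.
    by rewrite -(raddf_sum (comp (h + g))) /= -cy (compM_homog _ _ yg) addrK comp_iota.
  by rewrite big_map -mulr_sumr e rmorphV // mulKr.
move=> _ /mapP[w /wsP wm ->]; split.
  by have := gradeM (gradedExt_grade iota (grade_inv ch)) (comp_grade (h + g) w);
     rewrite addKr.
rewrite exprMn; apply: rpredM; first by rewrite rpredX ?iota_base.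
exact: comp_root graded_exponent_unit wm.
Qed.

End KummerGraded.

(** * The extension in degree 0 *)

Section DegreeZero.
Variables (T : torsionFreeZmodType) (F K : gradedFieldType T).
Variable iota : gradedExt F K.
Hypothesis kummerK : kummer_graded iota.
Let m := graded_exponent iota.

(** Membership in the F_0-span of s. *)
Definition spans0 (s : seq (deg0 K)) (y : K) : Prop :=
  exists2 cs : seq (deg0 F), size cs = size s &
    y = \sum_(p <- zip cs s) iota (val p.1) * val p.2.

Lemma spans0_cat s1 s2 y1 y2 :
  spans0 s1 y1 -> spans0 s2 y2 -> spans0 (s1 ++ s2) (y1 + y2).
Proof.
move=> [cs1 sz1 ->] [cs2 sz2 ->]; exists (cs1 ++ cs2); first by rewrite !size_cat sz1 sz2.
by rewrite zip_cat // big_cat.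
Qed.

Lemma spans0_flatten (I : Type) (r : seq I) (s : I -> seq (deg0 K)) (y : I -> K) :
  (forall j, spans0 (s j) (y j)) ->
  spans0 (flatten [seq s j | j <- r]) (\sum_(j <- r) y j).
Proof.
move=> sy; elim: r => [|j r IHr]; last by rewrite big_cons; apply: spans0_cat.
by exists [::]; rewrite ?big_nil.
Qed.

Lemma lift_deg0 (ys : seq K) : {in ys, forall x, x \in grade 0} ->
  exists ys0 : seq (deg0 K), ys = [seq val x | x <- ys0].
Proof.
move=> ys0; exists [seq insubd 0 x | x <- ys]; rewrite -map_comp map_id_in //.
by move=> x xs; rewrite /= insubdK //; exact: ys0.
Qed.

Lemma deg0_root (y : deg0 K) n : val y ^+ n \in base iota ->
  exists a, y ^+ n = ext0 iota a.
Proof.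
case/baseP => a ya.
have y0 : val y ^+ n \in grade 0.
  by have := gradeX n (valP y : val y \in grade 0); rewrite mul0rn.
have ca : comp 0 a \in deg0_pred F by exact: comp_grade.
exists (Sub (comp 0 a) ca); apply/val_inj; rewrite rmorphXn /=.
by rewrite -comp_iota -ya (comp_homog 0 y0) eqxx.
Qed.

Lemma deg0_kummer_decomposition (y : deg0 K) :
  exists2 ys : seq (deg0 K), y = \sum_(x <- ys) x &
    {in ys, forall x, exists a, x ^+ m = ext0 iota a}.
Proof.
have [ys yE ysP] := graded_kummer_decomposition kummerK (valP y : val y \in grade 0).
have [|ys0 ysE] := @lift_deg0 ys; first by move=> x /ysP[].
exists ys0; first by apply/val_inj; rewrite yE ysE big_map rmorph_sum.
move=> x xs; apply: deg0_root.
by have [|] := ysP (val x); first by rewrite ysE map_f.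
Qed.

(** Multiplied by a suitable unit of F, a homogeneous element whose degree comes
    from F moves to K_0. *)
Lemma homogeneous_span h (x : K) : x \in grade h ->
  exists2 ys : seq (deg0 K), {in ys, forall y, exists a, y ^+ m = ext0 iota a} &
    forall c : F, c \in grade (- h) -> spans0 ys (iota c * x).
Proof.
move=> xh.
have [[u uh nu]|nou] := pselect (exists2 u : F, u \in grade (- h) & u != 0); last first.
  exists [::] => // c ch; exists [::] => //; rewrite big_nil.
  have [->|nc] := eqVneq c 0; first by rewrite rmorph0 mul0r.
  by case: nou; exists c.
have ux0 : iota u * x \in deg0_pred K.
  by rewrite inE -(addNr h) gradeM //; exact: gradedExt_grade.
have [ys yE ysP] := deg0_kummer_decomposition (Sub (iota u * x) ux0).
exists ys => // c ch.
have c0 : c / u \in deg0_pred F.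
  by rewrite inE -(subrr (- h)) gradeM //; exact: grade_inv.
exists (nseq (size ys) (Sub (c / u) c0)); first by rewrite size_nseq.
transitivity (iota (c / u) * val (\sum_(y <- ys) y)).
  rewrite -yE /= mulrA -rmorphM divrK //; exact: grade_unit uh nu.
rewrite rmorph_sum mulr_sumr; elim: (ys) => [|y s IHs]; first by rewrite !big_nil.
by rewrite big_cons /= big_cons IHs.
Qed.

(** The degree-0 part of c_1 b_1 + ... + c_n b_n only involves products of
    components of opposite degrees of the c_j and of the b_j. *)
Lemma deg0_finite_span : exists ys : seq (deg0 K),
  {in ys, forall y, exists a, y ^+ m = ext0 iota a} /\
  forall y : deg0 K, spans0 ys (val y).
Proof.
have [n [b bP]] := kummerK.1.1.
have /choice[s sP] : forall p : 'I_n * T, exists ys : seq (deg0 K),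
    {in ys, forall y, exists a, y ^+ m = ext0 iota a} /\
    forall c : F, c \in grade (- p.2) -> spans0 ys (iota c * comp p.2 (b p.1)).
  move=> [j h]; have [ys ys1 ys2] := homogeneous_span (comp_grade h (b j)).
  by exists ys.
exists (flatten [seq flatten [seq s (j, h) | h <- supp_seq (b j)] | j <- enum 'I_n]).
split.
  move=> y /flatten_mapP[j _ /flatten_mapP[h _]].
  by have [+ _] := sP (j, h); apply.
move=> y; have [c [yE _]] := bP (val y).
have -> : val y = \sum_(j <- enum 'I_n) \sum_(h <- supp_seq (b j))
    iota (comp (- h) (c j)) * comp h (b j).
  have y0 : val y \in grade 0 := valP y.
  rewrite -[LHS](_ : comp 0 (val y) = _); last by rewrite (comp_homog 0 y0) eqxx.
  rewrite {1}yE raddf_sum /= big_enum; apply: eq_bigr => j _.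
  rewrite {1}(comp_sum (b j)) mulr_sumr raddf_sum /=; apply: eq_bigr => h _.
  by rewrite (compM_homog _ _ (comp_grade h (b j))) sub0r comp_iota.
apply: spans0_flatten => j; apply: spans0_flatten => h.
by have [_] := sP (j, h); apply; exact: comp_grade.
Qed.

Lemma deg0_model : inhabited (galoisModel (ext0 iota)).
Proof.
have [z zP] := graded_root_of_unity kummerK.
have [ys [ysm yspan]] := deg0_finite_span.
apply: (@kummer_model _ _ (ext0 iota) m z _ (tnth (in_tuple ys)) zP) => [y|j].
  have [cs szcs yE] := yspan y; exists (fun j => cs`_j).
  apply/val_inj; rewrite yE rmorph_sum /= (big_nth (0, 0)) big_mkord size_zip szcs minnn.
  by apply: eq_bigr => j _; rewrite nth_zip // (tnth_nth 0).
by apply: ysm; exact: mem_tnth.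
Qed.

Lemma deg0_exponent_dvd : (gal_exponent (ext0 iota) %| m)%N.
Proof.
have [z zP] := graded_root_of_unity kummerK; have [M0] := deg0_model.
have [M ->] := gal_exponentP M0.
exact: (model_exponent_dvd zP M deg0_kummer_decomposition).
Qed.

(** By Kummer theory for K_0/F_0, an m-th root of an element of F_0 is already
    an m0-th root of one, for the possibly smaller exponent m0. *)
Lemma deg0_root_exponent (y : deg0 K) a : y ^+ m = ext0 iota a ->
  exists b, y ^+ gal_exponent (ext0 iota) = ext0 iota b.
Proof.
have [z zP] := graded_root_of_unity kummerK; have [M0] := deg0_model.
by have [M ->] := gal_exponentP M0; exact: (model_root_exponent zP).
Qed.

End DegreeZero.

(** * The exact sequence *)

Section QuotientLift.
Local Open Scope quotient_scope.
Variables (A B : zmodType) (P : zmodClosed A).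
Local Notation class := (\pi_(Quotient.quot P)).

Lemma quot_eq (x y : A) : class x = class y <-> x - y \in P.
Proof. by rewrite Quotient.idealrBE; split => /eqP. Qed.

Lemma quot_classB : zmod_morphism class.
Proof. by move=> x y; rewrite !piE. Qed.

Lemma quot_lift (f : {additive A -> B}) : {in P, forall x, f x = 0} ->
  exists g : {additive Quotient.quot P -> B}, forall x, g (class x) = f x.
Proof.
move=> fP; pose g (q : Quotient.quot P) := f (generic_quotient.repr q).
have gE x : g (class x) = f x.
  apply/eqP; rewrite /g -subr_eq0 -raddfB; apply/eqP/fP.
  by apply/quot_eq; rewrite reprK.
have gB : zmod_morphism g.
  move=> p q; rewrite -[p]reprK -[q]reprK -quot_classB !gE.
  exact: raddfB.
pose gA : {additive Quotient.quot P -> B} :=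
  HB.pack g (GRing.isZmodMorphism.Build _ _ g gB).
by exists gA.
Qed.

End QuotientLift.

Section ExactSequence.
Local Open Scope quotient_scope.
Variables (T : torsionFreeZmodType) (F K : gradedFieldType T).
Variable iota : gradedExt F K.

Lemma gr_homog g (x : K) : x \in grade g -> x != 0 -> gr x = g.
Proof.
move=> xg nx.
have xgr : x \in grade (gr x).
  exact: (@classical_sets.xgetPex _ 0 (fun h => x \in grade h) (ex_intro _ g xg)).
exact: (graded_degree_unique gradingP xgr xg nx).
Qed.

Lemma unit_homog (x : K) : x \is a GRing.unit -> x \in grade (gr x) /\ x != 0.
Proof.
move=> ux; have nx : x != 0 by apply: contraTneq ux => ->; rewrite unitr0.
have [g xg] := graded_unit_homogeneous gradingP (@grade_unit T K) ux.
by rewrite (gr_homog xg nx).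
Qed.

Lemma gkum_unit (x : gKUM iota) : val x \is a GRing.unit.
Proof. by have /andP[] := valP x. Qed.

Lemma gkum_root (x : gKUM iota) : val x ^+ graded_exponent iota \in base iota.
Proof. by have /andP[] := valP x. Qed.

Lemma gkum_eq (x y : gKUM iota) :
  kum_class x = kum_class y <-> exists2 u, u \is a GRing.unit & val x / val y = iota u.
Proof.
apply: (iff_trans (quot_eq _ _ _)).
by split=> [/asboolP[u uu e]|[u uu e]]; [exists u|apply/asboolP; exists u].
Qed.

Lemma kum_class0 (R S : comUnitRingType) (i : unitExt R S) n :
  kum_class (0 : KUM i n) = 0.
Proof. by rewrite /kum_class -[0 in LHS](subrr 0) quot_classB subrr. Qed.

Hypothesis kummerK : kummer_graded iota.
Let m := graded_exponent iota.
Let m0 := gal_exponent (ext0 iota).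

Lemma KUM0_KUM (a : KUM0 iota) : val (val a) \in KUM_pred (graded_unitExt iota) m.
Proof.
have /andP[ua /asboolP[b ab]] := valP a.
rewrite inE; apply/andP; split; first exact: (rmorph_unit val).
apply/asboolP; have /dvdnP[k mE] := deg0_exponent_dvd kummerK.
exists (val (b ^+ k)); rewrite /m mE mulnC exprM -(rmorphXn val) ab -rmorphXn.
by rewrite -(rmorphXn (ext0_unitExt iota)).
Qed.

Definition incl_KUM (a : KUM0 iota) : gKUM iota := Sub (val (val a)) (KUM0_KUM a).
Definition phi_KUM (a : KUM0 iota) : gkum iota := kum_class (incl_KUM a).

Lemma phi_KUM_zmod : zmod_morphism phi_KUM.
Proof.
move=> a b; rewrite /phi_KUM /kum_class -quot_classB; congr (\pi_(Quotient.quot _) _).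
exact/val_inj.
Qed.
HB.instance Definition _ :=
  GRing.isZmodMorphism.Build (KUM0 iota) (gkum iota) phi_KUM phi_KUM_zmod.

Lemma deg_KUM_subproof (a : gKUM iota) : gr (val a) \in supp K.
Proof.
by have [xg nx] := unit_homog (gkum_unit a); apply/asboolP; exists (val a).
Qed.

Definition deg_KUM (a : gKUM iota) : degGroup K := Sub (gr (val a)) (deg_KUM_subproof a).
Definition psi_KUM (a : gKUM iota) : degQuot F K := degree_class F (deg_KUM a).

Lemma psi_KUM_zmod : zmod_morphism psi_KUM.
Proof.
move=> a b; rewrite /psi_KUM /degree_class -quot_classB; congr (\pi_(Quotient.quot _) _).
apply/val_inj => /=.
have [xa na] := unit_homog (gkum_unit a); have [xb nb] := unit_homog (gkum_unit b).
apply: gr_homog; first by apply: gradeM => //; exact: grade_inv.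
by rewrite mulf_neq0 ?invr_eq0.
Qed.
HB.instance Definition _ :=
  GRing.isZmodMorphism.Build (gKUM iota) (degQuot F K) psi_KUM psi_KUM_zmod.

Lemma phi_KUM_eq0 (a : KUM0 iota) :
  phi_KUM a = 0 <-> a \in @baseUnits _ _ (ext0_unitExt iota) m0.
Proof.
rewrite -(kum_class0 (graded_unitExt iota) m); apply: (iff_trans (gkum_eq _ _)).
split=> [[u uu]|/asboolP[u uu e]]; last first.
  by exists (val u); [exact: (rmorph_unit val)|rewrite /= divr1 e].
rewrite /= divr1 => e; apply/asboolP.
have ug0 : u \in deg0_pred F.
  have a0 : val (val a) \in grade 0 := valP (val a).
  rewrite inE -(_ : comp 0 u = u); first exact: comp_grade.
  by apply: (@iota_inj _ _ _ iota); rewrite -comp_iota -e (comp_homog 0 a0) eqxx.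
exists (Sub u ug0); last exact/val_inj.
by rewrite unitfE -(inj_eq val_inj) /=; apply: contraTneq uu => ->; rewrite unitr0.
Qed.

Lemma psi_KUM_eq0 (a : gKUM iota) : psi_KUM a = 0 <-> gr (val a) \in supp F.
Proof.
rewrite /psi_KUM -[X in _ = X](_ : degree_class F 0 = _); last first.
  by rewrite /degree_class -[0 in LHS](subrr 0) quot_classB subrr.
by apply: (iff_trans (quot_eq _ _ _)); rewrite subr0.
Qed.

(** An element of KUM(K/F) with the degree of some u in F is u times an element
    of KUM(K_0/F_0). *)
Lemma psi_KUM_kernel (b : gKUM iota) : gr (val b) \in supp F ->
  exists a : KUM0 iota, kum_class (incl_KUM a) = kum_class b.
Proof.
move=> /asboolP[u nu ub]; have [bg nb] := unit_homog (gkum_unit b).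
have uu := grade_unit ub nu; have uiu : iota u \is a GRing.unit by exact: rmorph_unit.
have y0 : val b / iota u \in deg0_pred K.
  rewrite inE -(subrr (gr (val b))) gradeM //; exact/grade_inv/gradedExt_grade.
pose y : deg0 K := Sub (val b / iota u) y0.
have ny : y != 0.
  by rewrite -(inj_eq val_inj) /= mulf_neq0 // invr_eq0 iota_eq0.
have yK : y \in KUM_pred (ext0_unitExt iota) m0.
  rewrite inE unitfE ny; apply/asboolP.
  have [a ya] : exists a, y ^+ m = ext0 iota a.
    apply: deg0_root; rewrite /= exprMn rpredM //; first exact: gkum_root.
    by rewrite rpredX // rpredV iota_base.
  exact: (deg0_root_exponent kummerK ya).
exists (Sub y yK); apply/gkum_eq; exists u^-1; first by rewrite unitrV.
by rewrite /= mulrAC divrr ?gkum_unit // mul1r rmorphV.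
Qed.

Lemma psi_KUM_surj (g : degGroup K) :
  exists b : gKUM iota, psi_KUM b = degree_class F g.
Proof.
have /asboolP[y ny yg] := valP g.
have [ys yE ysP] := graded_kummer_decomposition kummerK yg.
have [x xs nx] : exists2 x, x \in ys & x != 0.
  apply: contrapT => n; case/eqP: ny; rewrite yE big_seq big1 // => x xs.
  by apply/eqP/contraT => nx; case: n; exists x.
have [xg xm] := ysP x xs.
have xK : x \in KUM_pred (graded_unitExt iota) m.
  by rewrite inE (grade_unit xg nx).
exists (Sub x xK); rewrite /psi_KUM; congr (\pi_(Quotient.quot _) _).
by apply/val_inj; exact: gr_homog.
Qed.

End ExactSequence.

Theorem mainTheorem9 (T : torsionFreeZmodType) (F K : gradedFieldType T)
    (iota : gradedExt F K) (kummerK : kummer_graded iota) :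
  exists (phi : {additive kum0 iota -> gkum iota})
         (psi : {additive gkum iota -> degQuot F K}),
    [/\ forall a : KUM0 iota, exists2 b : gKUM iota,
          val b = val (val a) & phi (kum_class a) = kum_class b,
        forall a : gKUM iota, exists2 g : degGroup K,
          val g = gr (val a) & psi (kum_class a) = degree_class F g
      & short_exact phi psi].
Proof.
have [|phi phiE] := @quot_lift _ _
  (@baseUnits _ _ (ext0_unitExt iota) (gal_exponent (ext0 iota)))
  (phi_KUM kummerK).
  by move=> a aP; apply/phi_KUM_eq0.
have [|psi psiE] := @quot_lift _ _
  (@baseUnits _ _ (graded_unitExt iota) (graded_exponent iota))
  (@psi_KUM _ _ _ iota).
  move=> a /asboolP[u uu e]; apply/psi_KUM_eq0.
  have [ag na] := unit_homog (gkum_unit a).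
  have [h uh] := graded_unit_homogeneous gradingP (@grade_unit T F) uu.
  rewrite (@gr_homog _ _ h) //; last by rewrite e gradedExt_grade.
  by apply/asboolP; exists u => //; apply: contraTneq uu => ->; rewrite unitr0.
exists phi, psi; split.
- by move=> a; exists (incl_KUM kummerK a); [|exact: phiE].
- by move=> a; exists (deg_KUM a); [|exact: psiE].
split.
- apply: raddf_inj => q; rewrite -[q]reprK => e.
  have /phi_KUM_eq0 : phi_KUM kummerK (generic_quotient.repr q) = 0 by rewrite -phiE.
  by rewrite -[X in X \in _]subr0 => /quot_eq qE; exact: etrans qE (kum_class0 _ _).
- move=> q; split.
    rewrite -[q]reprK psiE => /psi_KUM_eq0/(psi_KUM_kernel kummerK)[a aE].
    by exists (kum_class a); rewrite [LHS]phiE.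
  case=> p <-; rewrite -[p]reprK phiE [LHS]psiE; apply/psi_KUM_eq0.
  set a := generic_quotient.repr p.
  have [_ na] := unit_homog (gkum_unit (incl_KUM kummerK a)).
  rewrite (gr_homog (valP (val a) : val (val a) \in grade 0) na); exact: rpred0.
- move=> c; rewrite -[c]reprK.
  have [b bE] := psi_KUM_surj kummerK (generic_quotient.repr c).
  by exists (kum_class b); exact: etrans (psiE b) bE.
Qed.
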